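(* Let $G_1$ and $G_2$ be $2$-connected tightly two-face-embeddable cubic graphs, let $e_i$ be an odd edge of $G_i$ ($i=1,2$), and let $G$ be an odd $2$-sum of $G_1$ and $G_2$ with respect to $e_1$ and $e_2$. Then $G$ is $2$-connected and tightly two-face-embeddable.
   Context: A cubic graph is $3$-regular; multiple edges allowed. For connected $G$, $\beta(G)=|E(G)|-|V(G)|+1$; $\gamma_M(G)$ is the largest genus of a closed orientable surface on which $G$ has a cellular embedding; $\xi(G)=\beta(G)-2\gamma_M(G)$. $G$ is upper-embeddable if $\xi(G)\le1$; an upper-embeddable cubic graph with odd $\beta$ is two-face-embeddable. In an upper-embeddable cubic graph $G$, a pair $\{x,y\}$ of distinct vertices is removable if $x,y$ are joined by exactly one edge, $xy$ is not a bridge, and $G-\{x,y\}$ is (connected and) upper-embeddable; a two-face-embeddable cubic graph is tightly two-face-embeddable if it has no removable pair. For a spanning tree $T$, the cotree is $G-E(T)$; a cotree component is odd if it has an odd number of edges; $T$ is a Xuong tree if its cotree has exactly $\xi(G)$ odd components. An edge $e$ of a tightly two-face-embeddable cubic graph $G$ is odd if there is a Xuong tree $T$ of $G$ such that the unique odd component of $G-E(T)$ consists of the single edge $e$. Odd $2$-sum: given such $G_1,G_2$ with odd edges $e_1,e_2$, form $(G_1-e_1)\cup(G_2-e_2)$ and add two independent edges $f_1,f_2$, each joining a $2$-valent vertex of $G_1-e_1$ to a $2$-valent vertex of $G_2-e_2$, so that the result is cubic. *)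

(* Defs.v *)
(* Finite multigraphs (loops and parallel edges allowed),
   given by a finite vertex type, a finite edge type and an end-vertex map.
   All notions are defined for "subgraphs" (VS, ES) of such a graph, so that
   deletions G - e, G - {x,y}, G - E(T) are expressed without new types. *)
From mathcomp Require Import all_boot fingroup perm.

Set Implicit Arguments.
Unset Strict Implicit.
Unset Printing Implicit Defensive.

Record graph := Graph {
  vert : finType;
  edge : finType;
  ends : edge -> (vert * vert)%type }.

Definition dart (G : graph) : finType := (edge G * bool)%type.

Definition head (G : graph) (d : dart G) : vert G :=
  if d.2 then (ends d.1).2 else (ends d.1).1.

Definition flip (G : graph) (d : dart G) : dart G := (d.1, ~~ d.2).

Definition incident (G : graph) (e : edge G) (v : vert G) : bool :=
  ((ends e).1 == v) || ((ends e).2 == v).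

Definition joins (G : graph) (e : edge G) (x y : vert G) : bool :=
  (ends e == (x, y)) || (ends e == (y, x)).

Definition sub_adj (G : graph) (VS : {set vert G}) (ES : {set edge G}) : rel (vert G) :=
  fun u v => [&& u \in VS, v \in VS & [exists e in ES, joins e u v]].

Definition connectedb (G : graph) (VS : {set vert G}) (ES : {set edge G}) : bool :=
  (VS != set0) && [forall u in VS, forall v in VS, connect (sub_adj VS ES) u v].

(* degree: number of darts at v (a loop counts twice) *)
Definition deg (G : graph) (ES : {set edge G}) (v : vert G) : nat :=
  #|[set d : dart G | (d.1 \in ES) && (head d == v)]|.

Definition cubicb (G : graph) (VS : {set vert G}) (ES : {set edge G}) : bool :=
  [forall v in VS, deg ES v == 3].

Definition beta (G : graph) (VS : {set vert G}) (ES : {set edge G}) : nat :=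
  (#|ES| + 1 - #|VS|)%N.

(* rotation systems (= cellular embeddings in closed orientable surfaces,
   Heffter-Edmonds): a permutation of the darts of ES whose cycles are exactly
   the sets of darts at each vertex; darts of edges outside ES are fixed. *)
Definition is_rotation (G : graph) (ES : {set edge G}) (rho : {perm dart G}) : bool :=
  [forall d : dart G, (d.1 \notin ES) ==> (rho d == d)] &&
  [forall d : dart G, (d.1 \in ES) ==> (head (rho d) == head d)] &&
  [forall d : dart G, forall d' : dart G,
     [&& d.1 \in ES, d'.1 \in ES & head d == head d'] ==> fconnect rho d d'].

Definition facemap (G : graph) (rho : {perm dart G}) (d : dart G) : dart G :=
  rho (flip d).

Definition nfaces (G : graph) (ES : {set edge G}) (rho : {perm dart G}) : nat :=
  #|[set [set d' | fconnect (facemap rho) d d'] | d in [set d : dart G | d.1 \in ES]]|.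

(* genus of the embedding, from Euler's formula |V| - |E| + |F| = 2 - 2g,
   i.e. 2g = beta + 1 - |F| *)
Definition genus_rot (G : graph) (VS : {set vert G}) (ES : {set edge G})
    (rho : {perm dart G}) : nat :=
  (beta VS ES + 1 - nfaces ES rho)./2.

Definition max_genus (G : graph) (VS : {set vert G}) (ES : {set edge G}) : nat :=
  \max_(rho : {perm dart G} | is_rotation ES rho) genus_rot VS ES rho.

Definition xi (G : graph) (VS : {set vert G}) (ES : {set edge G}) : nat :=
  (beta VS ES - 2 * max_genus VS ES)%N.

Definition upper_embeddable (G : graph) (VS : {set vert G}) (ES : {set edge G}) : bool :=
  connectedb VS ES && (xi VS ES <= 1).

Definition two_face_embeddable (G : graph) (VS : {set vert G}) (ES : {set edge G}) : bool :=
  [&& cubicb VS ES, upper_embeddable VS ES & odd (beta VS ES)].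

Definition del2V (G : graph) (VS : {set vert G}) (x y : vert G) : {set vert G} :=
  VS :\: [set x; y].
Definition del2E (G : graph) (ES : {set edge G}) (x y : vert G) : {set edge G} :=
  [set e in ES | ~~ incident e x && ~~ incident e y].

Definition removable (G : graph) (VS : {set vert G}) (ES : {set edge G}) (x y : vert G) : bool :=
  [&& x \in VS, y \in VS, x != y,
      #|[set e in ES | joins e x y]| == 1,
      [forall e in ES, joins e x y ==> connectedb VS (ES :\ e)] &
      upper_embeddable (del2V VS x y) (del2E ES x y)].

Definition tightly_tfe (G : graph) (VS : {set vert G}) (ES : {set edge G}) : bool :=
  two_face_embeddable VS ES && ~~ [exists x, exists y, removable VS ES x y].

(* spanning tree: connected spanning subgraph in which every edge is a bridge
   (i.e. minimally connected = acyclic and connected) *)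
Definition spanning_tree (G : graph) (VS : {set vert G}) (ES : {set edge G})
    (T : {set edge G}) : bool :=
  [&& T \subset ES, connectedb VS T & [forall e in T, ~~ connectedb VS (T :\ e)]].

Definition comp (G : graph) (VS : {set vert G}) (ES' : {set edge G}) (v : vert G)
  : {set vert G} := [set w in VS | connect (sub_adj VS ES') v w].

Definition components (G : graph) (VS : {set vert G}) (ES' : {set edge G})
  : {set {set vert G}} := [set comp VS ES' v | v in VS].

Definition comp_edges (G : graph) (ES' : {set edge G}) (C : {set vert G}) : {set edge G} :=
  [set e in ES' | ((ends e).1 \in C) && ((ends e).2 \in C)].

Definition odd_comps (G : graph) (VS : {set vert G}) (ES T : {set edge G})
  : {set {set vert G}} :=
  [set C in components VS (ES :\: T) | odd #|comp_edges (ES :\: T) C|].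

Definition xuong_tree (G : graph) (VS : {set vert G}) (ES T : {set edge G}) : bool :=
  spanning_tree VS ES T && (#|odd_comps VS ES T| == xi VS ES).

Definition odd_edge_sub (G : graph) (VS : {set vert G}) (ES : {set edge G}) (e : edge G) : Prop :=
  e \in ES /\
  exists T : {set edge G},
    [/\ xuong_tree VS ES T, e \notin T,
        odd_comps VS ES T = [set comp VS (ES :\: T) (ends e).1] &
        comp_edges (ES :\: T) (comp VS (ES :\: T) (ends e).1) = [set e]].

Definition two_connected_sub (G : graph) (VS : {set vert G}) (ES : {set edge G}) : bool :=
  [&& connectedb VS ES, 2 <= #|VS|,
      [forall e in ES, (ends e).1 != (ends e).2] &
      [forall v in VS, connectedb (VS :\ v) [set e in ES | ~~ incident e v]]].

Definition two_connected (G : graph) : bool := two_connected_sub [set: vert G] [set: edge G].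
Definition tightly_two_face_embeddable (G : graph) : bool :=
  tightly_tfe [set: vert G] [set: edge G].
Definition odd_edge (G : graph) (e : edge G) : Prop :=
  odd_edge_sub [set: vert G] [set: edge G] e.

(* Odd 2-sum. f b = (endpoint in G1, endpoint in G2) of the new edge f_b. *)
Definition sum2_edge (G1 G2 : graph) (e1 : edge G1) (e2 : edge G2) : finType :=
  ({x : edge G1 | x != e1} + {x : edge G2 | x != e2} + bool)%type.

Definition sum2_ends (G1 G2 : graph) (e1 : edge G1) (e2 : edge G2)
    (f : bool -> (vert G1 * vert G2)%type) (x : sum2_edge e1 e2)
    : ((vert G1 + vert G2) * (vert G1 + vert G2))%type :=
  match x with
  | inl (inl a) => (inl (ends (val a)).1, inl (ends (val a)).2)
  | inl (inr a) => (inr (ends (val a)).1, inr (ends (val a)).2)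
  | inr b => (inl (f b).1, inr (f b).2)
  end.

Definition sum2 (G1 G2 : graph) (e1 : edge G1) (e2 : edge G2)
    (f : bool -> (vert G1 * vert G2)%type) : graph :=
  @Graph (vert G1 + vert G2)%type (sum2_edge e1 e2) (sum2_ends f).

Definition odd2sum_data (G1 G2 : graph) (e1 : edge G1) (e2 : edge G2)
    (f : bool -> (vert G1 * vert G2)%type) : bool :=
  [&& [forall b, deg ([set: edge G1] :\ e1) (f b).1 == 2],
      [forall b, deg ([set: edge G2] :\ e2) (f b).2 == 2],
      (f false).1 != (f true).1,
      (f false).2 != (f true).2 &
      cubicb [set: vert (sum2 e1 e2 f)] [set: edge (sum2 e1 e2 f)]].

(* Main.v *)
From mathcomp Require Import all_boot fingroup perm zify.
Require Import Defs.

(** Everything is expressed through rotation systems.  Inserting or deleting a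
    dart multiplies the face permutation by a transposition, so face counts are
    controlled by cycle counts of permutations; their parity is [|V| + |E|].

    If [e1] is odd, the cotree minus [e1] splits into adjacent pairs, and adding
    such pairs to a one-face embedding of the tree keeps one face; adding [e1]
    then gives a two-face embedding with different faces on the two sides of
    [e1].  Two such embeddings merge into a two-face embedding of the sum.

    Let [{x, y}] be removable in the sum [G], so that [G - {x, y}] has a
    one-face embedding.  If [xy] is a new edge, the other new edge is a bridge
    of [G - {x, y}], and each side would have one face, against parity.  If
    [x, y] lie in [G1], not both on [e1], the embedding restricts to a one-face
    embedding of [G1 - {x, y}] (by parity [G2] receives two of the three
    resulting faces when both new edges survive), so [{x, y}] is removable in
    [G1].  If [x, y] are the ends of [e1], then [G - {x, y}] is disconnected. *)

Set Implicit Arguments.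
Unset Strict Implicit.
Unset Printing Implicit Defensive.

(** * Cycles of permutations *)

(** Faces are counted instead of genera. For odd [beta], two faces already give [xi <= 1]; for even
    [beta >= 2], [xi <= 1] yields a one-face embedding. Deleting a removable pair lowers [beta] by
    3, so the sum is to be embedded with two faces while its deletions come with one. Permutations
    always act on all darts, whichever edges are present: an absent edge is a cycle of the face
    permutation made of its two darts, and counting it separately lets edges come and go without a
    change of type. A two-sum keeps the rotations at all vertices and alters only the reversal of
    four darts, so its face permutation is that of the disjoint union times two transpositions. Each
    estimate comes from knowing which of them merges cycles. Parity closes the remaining gap: a
    cubic graph with odd [beta] has [|V| + |E|] even, so each of its embeddings has at least two
    faces. *)

Section Porbits.
Variable T : finType.
Implicit Types (s : {perm T}) (x y z : T) (O : {set T}).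

Lemma porbit_sub_closed s x O :
  x \in O -> (forall z, z \in O -> s z \in O) -> porbit s x \subset O.
Proof.
move=> xO Os; apply/subsetP=> y /porbitP[i ->]; rewrite permX.
by elim: i => //= i; exact: Os.
Qed.

Lemma porbit_step s x y : (s y \in porbit s x) = (y \in porbit s x).
Proof. by rewrite -!eq_porbit_mem (porbit_perm s 1 y). Qed.

Lemma mem_porbit_fconnect s x y : (y \in porbit s x) = fconnect s x y.
Proof.
apply/porbitP/idP => [[i ->]|/iter_findex <-]; first by rewrite permX fconnect_iter.
by exists (findex s x y); rewrite permX.
Qed.

Lemma porbit_trans s y x z :
  x \in porbit s y -> y \in porbit s z -> x \in porbit s z.
Proof. by rewrite -!eq_porbit_mem => /eqP->. Qed.

Lemma porbit_tperm_avoid s x y z :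
  x \notin porbit s z -> y \notin porbit s z ->
  porbit (tperm x y * s)%g z \subset porbit s z.
Proof.
move=> xz yz; apply: porbit_sub_closed; first exact: porbit_id.
move=> u uz; rewrite permM tpermD ?porbit_step //.
  by apply: contraNneq xz => ->.
by apply: contraNneq yz => ->.
Qed.

Lemma card_porbits_tperm s x y :
  #|porbits (tperm x y * s)%g| + 2 * (x \notin porbit s y) = #|porbits s| + (x != y).
Proof. by rewrite mul2n; exact: porbits_mul_tperm. Qed.

Lemma porbits_tperm_merge s x y :
  x \notin porbit s y -> #|porbits (tperm x y * s)%g| + 1 = #|porbits s|.
Proof.
move=> xy; have := porbits_mul_tperm s x y; rewrite /= xy /=.
by case: eqP xy => [->|_ _]; [rewrite porbit_id | lia].
Qed.

Lemma porbits_tperm_split s x y : x != y ->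
  x \in porbit s y -> #|porbits (tperm x y * s)%g| = #|porbits s| + 1.
Proof. by move=> nxy xy; have := porbits_mul_tperm s x y; rewrite /= nxy xy /=; lia. Qed.

Lemma porbits_tperm_le s x y : #|porbits (tperm x y * s)%g| <= #|porbits s| + 1.
Proof. by have := porbits_mul_tperm s x y => /=; case: (x != y) => /=; lia. Qed.

(** If [x] and [y] shared a cycle of the product, the same transposition applied again would split
    it, and [s] would have more cycles than the product. *)
Lemma porbits_tperm_splitN s x y :
  #|porbits s| < #|porbits (tperm x y * s)%g| -> x \notin porbit (tperm x y * s)%g y.
Proof.
move=> lt; apply/negP => xy; have nxy : x != y.
  by apply: contraTneq lt => ->; rewrite tperm1 mul1g ltnn.
have := porbits_tperm_split nxy xy; rewrite mulgA tperm2 mul1g; lia.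
Qed.

End Porbits.

(** * Permutations of a set that is a disjoint union of two images *)

Section PermImage.
Variables (T1 T2 T : finType).
Variables (i1 : T1 -> T) (i2 : T2 -> T).
Hypotheses (i1_inj : injective i1) (i2_inj : injective i2).
Hypothesis disj : forall x y, i1 x != i2 y.
Hypothesis covers : forall z, (exists x, z = i1 x) \/ (exists y, z = i2 y).

Lemma porbit_image (U : finType) (i : U -> T) (s : {perm U}) (t : {perm T}) x :
  (forall z, t (i z) = i (s z)) -> porbit t (i x) = i @: porbit s x.
Proof.
move=> ti; have tik k : (t ^+ k)%g (i x) = i ((s ^+ k)%g x).
  by rewrite !permX; elim: k => //= k ->.
apply/setP=> y; apply/porbitP/imsetP => [[k ->]|[z /porbitP[k ->] ->]].
  by exists ((s ^+ k)%g x); rewrite ?mem_porbit.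
by exists k.
Qed.

Lemma card_porbits_glue (s1 : {perm T1}) (s2 : {perm T2}) (t : {perm T}) :
  (forall z, t (i1 z) = i1 (s1 z)) -> (forall z, t (i2 z) = i2 (s2 z)) ->
  #|porbits t| = #|porbits s1| + #|porbits s2|.
Proof.
move=> t1 t2.
have -> : porbits t = [set i1 @: (A : {set T1}) | A in porbits s1]
                   :|: [set i2 @: (A : {set T2}) | A in porbits s2].
  apply/setP=> A; rewrite inE; apply/imsetP/orP => [[z _ ->]|].
    case: (covers z) => -[x ->]; [left|right]; apply/imsetP.
      by exists (porbit s1 x); rewrite ?imset_f ?inE // (porbit_image _ t1).
    by exists (porbit s2 x); rewrite ?imset_f ?inE // (porbit_image _ t2).
  case=> /imsetP[B /imsetP[x _ ->] ->].
    by exists (i1 x); rewrite ?inE // (porbit_image _ t1).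
  by exists (i2 x); rewrite ?inE // (porbit_image _ t2).
rewrite cardsU disjoint_setI0 ?cards0 ?subn0.
  by rewrite (card_imset _ (imset_inj i1_inj)) (card_imset _ (imset_inj i2_inj)).
apply/pred0P => A /=; apply/negP => /andP[/imsetP[B /imsetP[x _ ->] ->]].
case/imsetP=> C _ /setP/(_ (i1 x)).
rewrite imset_f ?porbit_id // => /esym/imsetP[y _ xy].
by have := disj x y; rewrite xy eqxx.
Qed.

Lemma perm_restrict (U : finType) (i : U -> T) (t : {perm T}) : injective i ->
  (forall x, exists y, t (i x) = i y) ->
  exists s : {perm U}, forall x, t (i x) = i (s x).
Proof.
move=> i_inj ti; have tib x : exists y, t (i x) == i y.
  by case: (ti x) => y ->; exists y.
pose g x := xchoose (tib x).
have gE x : t (i x) = i (g x) by apply/eqP; exact: (xchooseP (tib x)).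
have g_inj : injective g.
  by move=> x y gxy; apply: i_inj; apply: (@perm_inj _ t); rewrite !gE gxy.
by exists (perm g_inj) => x; rewrite permE gE.
Qed.

Lemma perm_glue (s1 : {perm T1}) (s2 : {perm T2}) :
  exists t : {perm T}, (forall z, t (i1 z) = i1 (s1 z)) /\
                       (forall z, t (i2 z) = i2 (s2 z)).
Proof.
(* [covers] is only a proposition, so the image of [z] is pinned down by a boolean condition from
   which [xchoose] can extract it; [disj] makes one of the two conjuncts vacuous. *)
have ex z : exists y, [forall x, (z == i1 x) ==> (y == i1 (s1 x))] &&
                      [forall x, (z == i2 x) ==> (y == i2 (s2 x))].
  case: (covers z) => -[x ->]; [exists (i1 (s1 x)) | exists (i2 (s2 x))];
    apply/andP; split; apply/forallP => x'; apply/implyP.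
  - by move/eqP/i1_inj->.
  - by move=> e; have := disj x x'; rewrite e.
  - by move=> e; have := disj x' x; rewrite eq_sym e.
  - by move/eqP/i2_inj->.
pose g z := xchoose (ex z).
have g1 x : g (i1 x) = i1 (s1 x).
  by case/andP: (xchooseP (ex (i1 x))) => /forallP/(_ x); rewrite eqxx => /eqP.
have g2 x : g (i2 x) = i2 (s2 x).
  by case/andP: (xchooseP (ex (i2 x))) => _ /forallP/(_ x); rewrite eqxx => /eqP.
have g_inj : injective g.
  move=> z z'; case: (covers z) (covers z') => -[x ->] [] [x' ->]; rewrite ?g1 ?g2.
  - by move/i1_inj/perm_inj->.
  - by move=> e; have := disj (s1 x) (s2 x'); rewrite e eqxx.
  - by move=> e; have := disj (s1 x') (s2 x); rewrite e eqxx.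
  - by move/i2_inj/perm_inj->.
by exists (perm g_inj); split=> z; rewrite permE ?g1 ?g2.
Qed.

End PermImage.

(** * Rotation systems *)

Section Rotations.
Variable G : graph.
Implicit Types (d c : dart G) (D : {set dart G}) (rho : {perm dart G}).
Implicit Types (ES : {set edge G}) (VS : {set vert G}).

Definition darts ES : {set dart G} := [set d | d.1 \in ES].

(** Stated for a set of darts rather than of edges, so that the two darts of an edge can be inserted
    or deleted one at a time. *)
Record rotation_on D rho : Prop := RotationOn {
  rotation_fix : forall d, d \notin D -> rho d = d;
  rotation_head : forall d, head (rho d) = head d;
  rotation_cyclic : forall d d', d \in D -> d' \in D -> head d = head d' ->
    d' \in porbit rho d }.

Lemma is_rotationP ES rho : reflect (rotation_on (darts ES) rho) (is_rotation ES rho).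
Proof.
apply: (iffP andP) => [[/andP[/forallP h1 /forallP h2] /forallP h3]|[h1 h2 h3]].
  have fixE d : d \notin darts ES -> rho d = d.
    by rewrite inE => dE; apply/eqP; apply: (implyP (h1 d)).
  split=> // [d|d d'].
    have [dE|/fixE-> //] := boolP (d \in darts ES).
    by apply/eqP; apply: (implyP (h2 d)); rewrite inE in dE.
  rewrite !inE => dE dE' hd; rewrite mem_porbit_fconnect.
  by apply: (implyP (forallP (h3 d) d')); rewrite dE dE' hd eqxx.
split; first (apply/andP; split); apply/forallP=> d.
- by apply/implyP => dE; rewrite h1 // inE.
- by apply/implyP => dE; rewrite h2.
- apply/forallP=> d'; apply/implyP=> /and3P[dE dE' /eqP hd].
  by rewrite -mem_porbit_fconnect; apply: h3; rewrite ?inE.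
Qed.

Lemma rotation_dom D rho d : rotation_on D rho -> (rho d \in D) = (d \in D).
Proof.
move=> rot; apply/idP/idP => dD; apply: contraTT (dD) => dND.
  by rewrite (rotation_fix rot dND).
by rewrite -(perm_inj (rotation_fix rot dND)).
Qed.

(** Products act from left to right: [c] now goes to [d] and [d] to [rho c], which splices [d] into
    the cycle just after [c]. *)
Lemma rotation_insert D rho c d : rotation_on D rho -> d \notin D -> c \in D ->
  head c = head d -> rotation_on (d |: D) (tperm c d * rho)%g.
Proof.
move=> [fixD hdD cyc] dD cD hcd.
have nC : c != d by apply: contraNneq dD => <-.
have : (tperm c d * rho)%g c = d by rewrite permM tpermL fixD.
have : (tperm c d * rho)%g d = rho c by rewrite permM tpermR.
have : forall z, z != c -> z != d -> (tperm c d * rho)%g z = rho z.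
  by move=> z zc zd; rewrite permM tpermD // eq_sym.
move: (tperm c d * rho)%g => rho' rz rd rc.
have sub x : porbit rho x \subset porbit rho' x.
  apply: porbit_sub_closed => [|z zO]; first exact: porbit_id.
  have [zc|zc] := eqVneq z c; first by rewrite zc -rd porbit_step -rc porbit_step -zc.
  have [zd|zd] := eqVneq z d; first by rewrite zd fixD // -?zd.
  by rewrite -rz // porbit_step.
split=> [z|z|z z'].
- rewrite in_setU1 negb_or => /andP[zd zD]; rewrite rz ?fixD //.
  by apply: contraNneq zD => ->.
- have [->|zc] := eqVneq z c; first by rewrite rc hcd.
  have [->|zd] := eqVneq z d; first by rewrite rd hdD.
  by rewrite rz.
- have key u : u \in D -> head u = head d -> d \in porbit rho' u.
    move=> uD hu; rewrite -rc porbit_step (subsetP (sub u)) // cyc //.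
    by rewrite hu hcd.
  case/setU1P => [->|zD] /setU1P[->|zD'] hz.
  + exact: porbit_id.
  + by rewrite porbit_sym key.
  + exact: key.
  + by rewrite (subsetP (sub z)) // cyc.
Qed.

Lemma rotation_insert_isolated D rho d : rotation_on D rho -> d \notin D ->
  (forall c, c \in D -> head c != head d) -> rotation_on (d |: D) rho.
Proof.
move=> [fixD hdD cyc] dD iso; split=> // [z|z z'].
  by rewrite in_setU1 negb_or => /andP[_]; exact: fixD.
case/setU1P => [->|zD] /setU1P[->|zD'] hz; first exact: porbit_id.
- by have := iso _ zD'; rewrite hz eqxx.
- by have := iso _ zD; rewrite hz eqxx.
- exact: cyc.
Qed.

(** The predecessor of [d] is sent to [rho d], and [d] becomes a fixed point. *)
Lemma rotation_delete D rho d : rotation_on D rho ->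
  rotation_on (D :\ d) (tperm (rho^-1%g d) d * rho)%g.
Proof.
move=> [fixD hdD cyc]; have rc : rho (rho^-1%g d) = d by rewrite permKV.
move: (rho^-1%g d) rc => c rc.
have : (tperm c d * rho)%g d = d by rewrite permM tpermR.
have : (tperm c d * rho)%g c = rho d by rewrite permM tpermL.
have : forall z, z != c -> z != d -> (tperm c d * rho)%g z = rho z.
  by move=> z zc zd; rewrite permM tpermD // eq_sym.
move: (tperm c d * rho)%g => rho' rz rc' rd.
split=> [z|z|z z'].
- rewrite !inE negb_and negbK => /orP[/eqP->//|zD].
  have [zd|zd] := eqVneq z d; first by rewrite zd.
  rewrite rz ?fixD //; apply: contraNneq zd => zc.
  by rewrite -rc -zc fixD.
- have [->|zd] := eqVneq z d; first by rewrite rd.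
  have [->|zc] := eqVneq z c; last by rewrite rz.
  by rewrite rc' hdD -[in LHS]rc hdD.
rewrite !in_setD1 => /andP[zd zD] /andP[zd' zD'] hz.
have dO : d \notin porbit rho' z.
  rewrite porbit_sym; apply: contra zd => /porbitP[i ->].
  by rewrite permX; elim: i => //= i /eqP->; rewrite rd.
(* Putting [d] back into the new cycle when its predecessor [c] lies there gives a set closed under
   [rho]; it contains the old cycle, hence [z']. *)
pose O := porbit rho' z :|: [set x in [:: d] | c \in porbit rho' z].
have : porbit rho z \subset O.
  apply: porbit_sub_closed => [|u]; first by rewrite inE porbit_id.
  rewrite !inE => /orP[uO|/andP[/eqP-> cO]]; last by rewrite -rc' porbit_step cO.
  have [uc|uc] := eqVneq u c; first by rewrite uc rc eqxx -uc uO orbT.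
  rewrite -rz ?porbit_step ?uO //.
  by apply: contraNneq dO => <-.
move/subsetP/(_ z' (cyc _ _ zD zD' hz)); rewrite !inE => /orP[//|/andP[]].
by rewrite (negPf zd').
Qed.

(** * Face permutations and the parity of the number of faces *)

Lemma flipK : involutive (@flip G).
Proof. by case=> e b; rewrite /flip /= negbK. Qed.

Definition flip_perm : {perm dart G} := perm (inv_inj flipK).

Definition face_perm rho : {perm dart G} := (flip_perm * rho)%g.

Lemma face_permE rho d : face_perm rho d = rho (flip d).
Proof. by rewrite permM permE. Qed.

Lemma flip_perm_tperm x y :
  (flip_perm * tperm x y = tperm (flip x) (flip y) * flip_perm)%g.
Proof.
have fV z : (flip_perm^-1)%g z = flip z.
  by apply: (@perm_inj _ flip_perm); rewrite permKV permE flipK.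
by rewrite conjgCV tpermJ !fV.
Qed.

Lemma face_perm_tperm rho c d :
  face_perm (tperm c d * rho)%g = (tperm (flip c) (flip d) * face_perm rho)%g.
Proof. by rewrite /face_perm mulgA flip_perm_tperm mulgA. Qed.

Lemma flip_darts ES d : (flip d \in darts ES) = (d \in darts ES).
Proof. by rewrite !inE. Qed.

Lemma face_perm_dom ES rho d : rotation_on (darts ES) rho ->
  (face_perm rho d \in darts ES) = (d \in darts ES).
Proof. by move=> rot; rewrite face_permE (rotation_dom _ rot) flip_darts. Qed.

Lemma face_porbit_darts ES rho d d' : rotation_on (darts ES) rho ->
  d' \in porbit (face_perm rho) d -> (d' \in darts ES) = (d \in darts ES).
Proof.
move=> rot /porbitP[i ->]; rewrite permX.
by elim: i => //= i IH; rewrite face_perm_dom.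
Qed.

Lemma face_porbit_outside ES rho e b : rotation_on (darts ES) rho -> e \notin ES ->
  porbit (face_perm rho) (e, b) = [set d | d.1 == e].
Proof.
move=> rot eE.
have fE b' : face_perm rho (e, b') = (e, ~~ b').
  by rewrite face_permE (rotation_fix rot) // inE.
apply/eqP; rewrite eqEsubset; apply/andP; split.
  apply: porbit_sub_closed => [|[e' b']]; first by rewrite inE.
  by rewrite inE /= => /eqP->; rewrite fE inE.
apply/subsetP=> -[e' b']; rewrite inE /= => /eqP->.
have [->|nb] := eqVneq b' b; first exact: porbit_id.
have -> : b' = ~~ b by case: b' b nb => [] [].
by rewrite -fE porbit_step porbit_id.
Qed.

Lemma nfacesE ES rho :
  nfaces ES rho = #|[set porbit (face_perm rho) d | d in darts ES]|.
Proof.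
rewrite /nfaces; congr #|pred_of_set _|; apply: eq_imset => d.
apply/setP=> d'; rewrite inE mem_porbit_fconnect.
by apply: eq_fconnect => z; rewrite face_permE.
Qed.

(** The two darts of an edge outside [ES] form one further cycle. With this correction the
    transposition formulas become statements about faces. *)
Lemma card_porbits_face ES rho : rotation_on (darts ES) rho ->
  #|porbits (face_perm rho)| = nfaces ES rho + #|~: ES|.
Proof.
move=> rot; rewrite nfacesE.
have -> : porbits (face_perm rho) = [set porbit (face_perm rho) d | d in darts ES]
    :|: [set porbit (face_perm rho) ((e, false) : dart G) | e in ~: ES].
  apply/setP=> A; rewrite inE; apply/imsetP/orP => [[[e b] _ ->]|].
    have [eE|eE] := boolP (e \in ES); [left|right]; apply/imsetP.
      by exists (e, b); rewrite ?inE.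
    by exists e; rewrite ?inE // !(face_porbit_outside _ rot eE).
  by case=> /imsetP[z _ ->]; [exists z | exists (z, false)].
rewrite cardsU disjoint_setI0 ?cards0 ?subn0.
  congr (_ + _); apply: card_in_imset => e e'; rewrite !inE => eE eE'.
  rewrite !(face_porbit_outside _ rot) // => /setP/(_ (e, false)).
  by rewrite !inE /= eqxx => /esym/eqP.
apply/pred0P => A /=; apply/negP => /andP[/imsetP[d dE ->] /imsetP[e eE E]].
have : (e, false) \in porbit (face_perm rho) d by rewrite E porbit_id.
by move/(face_porbit_darts rot); rewrite dE !inE in eE *; rewrite (negPf eE).
Qed.

Lemma nfaces_gt0 ES rho : ES != set0 -> 0 < nfaces ES rho.
Proof.
case/set0Pn=> e eE; rewrite nfacesE card_gt0; apply/set0Pn.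
by exists (porbit (face_perm rho) (e, false)); apply: imset_f; rewrite inE.
Qed.

Lemma card_darts ES : #|darts ES| = #|ES|.*2.
Proof.
have -> : darts ES = setX ES [set: bool] by apply/setP=> -[e b]; rewrite !inE andbT.
by rewrite cardsX cardsT card_bool muln2.
Qed.

Lemma rotation_set0 : rotation_on (darts set0) 1%g.
Proof. by split=> [d|d|d d']; rewrite ?perm1 // inE in_set0. Qed.

(** Cycles inside [ES] correspond to vertices because every vertex of [VS] carries a dart; an
    isolated vertex would have no cycle. Darts outside [ES] are fixed points, two per edge. *)
Lemma card_porbits_rotation VS ES rho : rotation_on (darts ES) rho ->
  (forall d, d \in darts ES -> head d \in VS) ->
  (forall v, v \in VS -> exists2 d, d \in darts ES & head d = v) ->
  #|porbits rho| = #|VS| + #|~: ES|.*2.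
Proof.
move=> rot EV VE; rewrite -card_darts.
have orb d : d \in darts ES ->
    porbit rho d = [set d' in darts ES | head d' == head d].
  move=> dE; apply/eqP; rewrite eqEsubset; apply/andP; split; last first.
    apply/subsetP => d'; rewrite inE => /andP[dE' /eqP hd].
    exact: (rotation_cyclic rot).
  apply: porbit_sub_closed => [|z]; first by rewrite inE dE eqxx.
  by rewrite !inE => /andP[zE /eqP <-]; move: (rotation_dom z rot); rewrite !inE => ->;
     rewrite zE (rotation_head rot) eqxx.
have orbN d : d \in darts (~: ES) -> porbit rho d = [set d].
  rewrite !inE => dE; apply/eqP; rewrite eqEsubset sub1set porbit_id andbT.
  apply: porbit_sub_closed => [|z]; first by rewrite inE.
  by rewrite !inE => /eqP->; rewrite (rotation_fix rot) // inE.
have -> : porbits rho = [set [set d' in darts ES | head d' == v] | v in VS]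
    :|: [set [set d] | d in darts (~: ES)].
  apply/setP=> A; rewrite inE; apply/imsetP/orP => [[d _ ->]|].
    have [dE|dE] := boolP (d \in darts ES); [left|right]; apply/imsetP.
      by exists (head d); rewrite ?orb ?EV.
    by have dE' : d \in darts (~: ES); [rewrite !inE in dE * | exists d; rewrite ?orbN].
  case=> /imsetP[z zE ->].
    by have [d dE <-] := VE z zE; exists d; rewrite ?orb.
  by exists z; rewrite ?orbN.
rewrite cardsU disjoint_setI0 ?cards0 ?subn0.
  congr (_ + _); last by rewrite card_imset //; exact: set1_inj.
  apply: card_in_imset => v w vV wV /setP.
  have [d dE <-] := VE v vV => /(_ d); rewrite !inE eqxx; rewrite inE in dE.
  by rewrite dE => /esym/eqP.
apply/pred0P => A /=; apply/negP => /andP[/imsetP[v vV ->] /imsetP[d dE E]].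
have : d \in [set d] by rewrite inE.
by rewrite -E !inE => /andP[]; rewrite !inE in dE; rewrite (negPf dE).
Qed.

(** Euler's formula modulo 2: the sign of the face permutation is that of the reversal times that of
    the rotation, and signs are read off the numbers of cycles. *)
Lemma nfaces_parity VS ES rho : rotation_on (darts ES) rho ->
  (forall d, d \in darts ES -> head d \in VS) ->
  (forall v, v \in VS -> exists2 d, d \in darts ES & head d = v) ->
  odd (nfaces ES rho) = odd (#|VS| + #|ES|).
Proof.
move=> rot EV VE.
have dE : #|{: dart G}| = #|edge G|.*2 by rewrite card_prod card_bool muln2.
(* For the empty edge set with the identity rotation, the face permutation is the reversal itself,
   with one cycle per edge. *)
have flipE : odd_perm flip_perm = odd #|edge G|.
  have := card_porbits_face rotation_set0.
  rewrite /face_perm mulg1 /odd_perm => ->; rewrite dE odd_double /= setC0 cardsT.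
  by rewrite nfacesE (_ : darts _ = set0) ?imset0 ?cards0 //; apply/setP => d; rewrite !inE.
have := odd_permM flip_perm rho; rewrite flipE -/(face_perm rho) /odd_perm.
rewrite (card_porbits_face rot) (card_porbits_rotation rot EV VE) dE odd_double /=.
have := cardsC ES; rewrite !oddD odd_double addbF => /(congr1 odd).
rewrite oddD => <-.
by case: (odd #|ES|) (odd #|~: ES|) (odd #|VS|) (odd (nfaces _ _)) => [] [] [] [].
Qed.

Lemma darts_setU1 e ES : darts (e |: ES) = (e, true) |: ((e, false) |: darts ES).
Proof. by apply/setP=> -[e' []]; rewrite !inE /= !xpair_eqE /= ?andbT ?andbF. Qed.

Lemma darts_setU1b e b ES : darts (e |: ES) = (e, b) |: ((e, ~~ b) |: darts ES).
Proof. by rewrite darts_setU1; case: b => //; rewrite setUCA. Qed.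

(** Each of the two darts costs at most one extra cycle, but one cycle is then taken by the deleted
    edge itself, hence one more face and not two. *)
Lemma nfaces_delete ES rho e : rotation_on (darts ES) rho -> e \in ES ->
  exists2 rho', rotation_on (darts (ES :\ e)) rho' & nfaces (ES :\ e) rho' <= (nfaces ES rho).+1.
Proof.
move=> rot eE; pose d1 : dart G := (e, true); pose d2 : dart G := (e, false).
have rot1 := rotation_delete d1 rot; have rot2 := rotation_delete d2 rot1.
have dE : darts ES :\ d1 :\ d2 = darts (ES :\ e).
  by apply/setP=> -[e' []]; rewrite !inE /= !xpair_eqE /= ?andbT ?andbF.
rewrite dE in rot2; set rho2 := (_ * _)%g in rot2; exists rho2 => //.
have := card_porbits_face rot; move: rot2.
move/card_porbits_face; rewrite !face_perm_tperm.
set x := flip _; set y := flip _; set z := flip _; set w := flip _.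
have := porbits_tperm_le (face_perm rho) z w.
have := porbits_tperm_le (tperm z w * face_perm rho)%g x y.
have := cardsC ES; have := cardsC (ES :\ e); have := cardsD1 e ES; rewrite eE.
lia.
Qed.

End Rotations.

(** * Connectivity *)

Lemma connect_hom (T U : finType) (r : rel T) (r' : rel U) (h : T -> U) x y :
  (forall u v, r u v -> connect r' (h u) (h v)) ->
  connect r x y -> connect r' (h x) (h y).
Proof.
move=> hr /connectP[p]; elim: p x => [|z p IH] x /=; first by move=> _ ->.
by case/andP=> /hr xz zp yE; exact: connect_trans xz (IH _ zp yE).
Qed.

Section Connectivity.
Variable G : graph.
Implicit Types (d c : dart G) (ES : {set edge G}) (VS : {set vert G}).

Lemma joinsP (e : edge G) x y :
  reflect (exists s, head ((e, s) : dart G) = x /\ head ((e, ~~ s) : dart G) = y)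
          (joins e x y).
Proof.
rewrite /joins /head; case E: (ends e) => [a b]; rewrite !xpair_eqE.
apply: (iffP orP) => [[] /andP[/eqP<- /eqP<-]|[[] [/=]]]; rewrite /= ?E /=.
- by exists false; split; rewrite /= ?E.
- by exists true; split; rewrite /= ?E.
- by move=> -> ->; rewrite !eqxx; right.
- by move=> -> ->; rewrite !eqxx; left.
Qed.

Lemma incidentP (e : edge G) v :
  reflect (exists s, head ((e, s) : dart G) = v) (incident e v).
Proof.
rewrite /incident /head; apply: (iffP orP) => [[] /eqP<-|[[] /= ->]].
- by exists false.
- by exists true.
- by right.
- by left.
Qed.

Lemma sub_adjP VS ES u v :
  reflect [/\ u \in VS, v \in VS &
    exists d, [/\ d \in darts ES, head d = u & head (flip d) = v]]
    (sub_adj VS ES u v).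
Proof.
apply: (iffP and3P) => [[uV vV /existsP[e /andP[eE /joinsP[s [hu hv]]]]]|].
  by split=> //; exists (e, s); rewrite inE.
case=> uV vV [[e s] []]; rewrite inE /= => eE hu hv; split=> //.
by apply/existsP; exists e; rewrite eE; apply/joinsP; exists s.
Qed.

Lemma sub_adj_sym VS ES : symmetric (sub_adj VS ES).
Proof.
have h u v : sub_adj VS ES u v -> sub_adj VS ES v u.
  case/sub_adjP=> uV vV [d [dE hu hv]]; apply/sub_adjP; split=> //.
  by exists (flip d); rewrite flip_darts flipK.
by move=> u v; apply/idP/idP; exact: h.
Qed.

Lemma connect_sub_adj_sym VS ES : connect_sym (sub_adj VS ES).
Proof. exact/sym_connect_sym/sub_adj_sym. Qed.

Lemma sub_adj_mono VS ES VS' ES' : VS \subset VS' -> ES \subset ES' ->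
  forall u v, connect (sub_adj VS ES) u v -> connect (sub_adj VS' ES') u v.
Proof.
move=> sV sE; apply: connect_sub => u v /sub_adjP[uV vV [d [dE hu hv]]].
apply/connect1/sub_adjP; rewrite !(subsetP sV) //; split=> //.
by exists d; split=> //; rewrite !inE in dE *; rewrite (subsetP sE).
Qed.

Lemma connectedb_root VS ES r : r \in VS ->
  (forall v, v \in VS -> connect (sub_adj VS ES) r v) -> connectedb VS ES.
Proof.
move=> rV rc; apply/andP; split; first by apply/set0Pn; exists r.
apply/forallP=> u; apply/implyP=> uV; apply/forallP=> v; apply/implyP=> vV.
by rewrite (connect_trans _ (rc _ vV)) // connect_sub_adj_sym rc.
Qed.

Lemma connectedb_connect VS ES u v : connectedb VS ES -> u \in VS -> v \in VS ->
  connect (sub_adj VS ES) u v.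
Proof.
by case/andP=> _ /forallP/(_ u)/implyP h uV vV; apply: (implyP (forallP (h uV) v)).
Qed.

Lemma connectedb_neq0 VS ES : connectedb VS ES -> exists v, v \in VS.
Proof. by case/andP=> /set0Pn. Qed.

Lemma connectedb_mono VS ES ES' : ES \subset ES' -> connectedb VS ES -> connectedb VS ES'.
Proof.
move=> sE con; have [r rV] := connectedb_neq0 con.
apply: (connectedb_root rV) => v vV.
by apply: (sub_adj_mono (subxx VS) sE); apply: connectedb_connect.
Qed.

Lemma connected_crossing VS ES (W : {set vert G}) u v :
  connectedb VS ES -> u \in VS -> v \in VS -> u \in W -> v \notin W ->
  exists d, [/\ d \in darts ES, head d \in W, head d \in VS,
                head (flip d) \in VS & head (flip d) \notin W].
Proof.
move=> con uV vV uW vW.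
have [/existsP[d /and5P[]]|noex] := boolP [exists d, [&& d \in darts ES, head d \in W,
    head d \in VS, head (flip d) \in VS & head (flip d) \notin W]]; first by exists d.
have cl : closed (sub_adj VS ES) W.
  apply: intro_closed; first exact: connect_sub_adj_sym.
  move=> x y /sub_adjP[xV yV [d [dE hx hy]]] xW; apply: contraNT noex => yW.
  by apply/existsP; exists d; rewrite dE hx hy xW xV yV.
by move: vW; rewrite -(closed_connect cl (connectedb_connect con uV vV)) uW.
Qed.

Lemma connected_has_dart VS ES v : connectedb VS ES -> v \in VS -> 2 <= #|VS| ->
  exists2 d, d \in darts ES & head d = v.
Proof.
move=> con vV; rewrite (cardsD1 v) vV /= => /card_gt0P[w].
rewrite !inE => /andP[wv wV].
have [||d [dE + _ _ _]] := connected_crossing (W := [set v]) con vV wV.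
- by rewrite inE.
- by rewrite inE.
- by rewrite inE => /eqP <-; exists d.
Qed.

End Connectivity.

(** * Adding edges to an embedding *)

Section EdgeInsertion.
Variable G : graph.
Implicit Types (d c : dart G) (rho : {perm dart G}).
Implicit Types (ES : {set edge G}) (VS : {set vert G}).

(** The dart [(e, s)] is placed right after [c1], its reverse right after [c2]. The corner after a
    dart [c] belongs to the face of [flip c], since [face_perm rho (flip c) = rho c]; this is why
    the faces of [flip c1] and [flip c2] matter below. *)
Definition insert_edge rho (e : edge G) (s : bool) c1 c2 : {perm dart G} :=
  (tperm c1 (e, s) * (tperm c2 (e, ~~ s) * rho))%g.

Lemma face_insert_edge rho e s c1 c2 : face_perm (insert_edge rho e s c1 c2) =
  (tperm (flip c1) (e, ~~ s) * (tperm (flip c2) (e, s) * face_perm rho))%g.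
Proof. by rewrite !face_perm_tperm /flip /= negbK. Qed.

Section Insert.
Variables (ES : {set edge G}) (rho : {perm dart G}) (e : edge G) (s : bool) (c1 c2 : dart G).
Hypotheses (rot : rotation_on (darts ES) rho) (eE : e \notin ES).
Hypotheses (c1E : c1 \in darts ES) (c2E : c2 \in darts ES).
Hypotheses (hc1 : head c1 = head ((e, s) : dart G)).
Hypotheses (hc2 : head c2 = head ((e, ~~ s) : dart G)).
Let rho' := insert_edge rho e s c1 c2.

Lemma rotation_insert_edge : rotation_on (darts (e |: ES)) rho'.
Proof.
rewrite (darts_setU1b e s); apply: rotation_insert => //.
- by apply: rotation_insert; rewrite // ?inE.
- by rewrite !inE /= xpair_eqE eqxx (negPf eE) orbF; case: (s).
- by rewrite inE c1E orbT.
Qed.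

Let cardC : #|~: ES| = #|~: (e |: ES)| + 1.
Proof. by have := cardsC ES; have := cardsC (e |: ES); rewrite cardsU1 eE; lia. Qed.

(** The first transposition always attaches the two-dart cycle of the absent edge [e] to the face at
    [c2]. *)
Let merge1 : #|porbits (tperm (flip c2) (e, s) * face_perm rho)%g| + 1
  = #|porbits (face_perm rho)|.
Proof.
apply: porbits_tperm_merge; apply/negP=> /(face_porbit_darts rot).
by rewrite flip_darts c2E !inE (negPf eE).
Qed.

(** The first transposition merges; if the second one merged as well, the cycle count would leave no
    face at all. So it splits, and a splitting transposition separates its two points. *)
Lemma insert_edge_split : nfaces ES rho <= 1 ->
  nfaces (e |: ES) rho' = 2 /\ (e, s) \notin porbit (face_perm rho') (e, ~~ s).
Proof.
move=> nf; have nf1 : nfaces ES rho = 1.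
  have := nfaces_gt0 rho (ES := ES); have -> : ES != set0; last by move/(_ isT); lia.
  by apply/set0Pn; exists c1.1; move: c1E; rewrite inE.
have nf'0 : 0 < nfaces (e |: ES) rho'.
  by apply: nfaces_gt0; apply/set0Pn; exists e; rewrite !inE eqxx.
pose s2 : {perm dart G} := (tperm (flip c2) (e, s) * face_perm rho)%g.
have m1 : #|porbits s2| + 1 = #|porbits (face_perm rho)| := merge1.
have fE : face_perm rho' = (tperm (flip c1) (e, ~~ s) * s2)%g := face_insert_edge _ _ _ _ _.
have cC := cardC.
have cf := card_porbits_face rot; have cf' := card_porbits_face rotation_insert_edge.
have := card_porbits_tperm s2 (flip c1) (e, ~~ s).
rewrite -fE.
have -> : flip c1 != (e, ~~ s).
  by apply: contraNneq eE => h; move: c1E; rewrite -flip_darts h inE.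
have [_|ins] := boolP (flip c1 \in _) => E; last by exfalso; lia.
split; first by lia.
have : flip c1 \notin porbit (face_perm rho') (e, ~~ s).
  by rewrite fE; apply: porbits_tperm_splitN; rewrite -fE; lia.
(* [flip c1] and [(e, s)] are on the same face, because the new face permutation sends the first to
   the second. *)
apply: contra => es; rewrite -porbit_step face_permE flipK.
rewrite permM tpermL permM tpermD ?(rotation_fix rot) ?inE //.
  by apply: contraNneq eE => h; move: c2E; rewrite h inE.
by rewrite xpair_eqE eqxx; case: (s).
Qed.

Lemma insert_edge_merge : flip c1 \notin porbit (face_perm rho) (flip c2) ->
  nfaces (e |: ES) rho' + 1 = nfaces ES rho.
Proof.
move=> c12.
pose s2 : {perm dart G} := (tperm (flip c2) (e, s) * face_perm rho)%g.
have m1 : #|porbits s2| + 1 = #|porbits (face_perm rho)| := merge1.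
have fE : face_perm rho' = (tperm (flip c1) (e, ~~ s) * s2)%g := face_insert_edge _ _ _ _ _.
have cC := cardC.
have cf := card_porbits_face rot; have cf' := card_porbits_face rotation_insert_edge.
have out b : (e, b) \notin porbit (face_perm rho) (flip c1).
  by apply/negP=> /(face_porbit_darts rot); rewrite flip_darts c1E !inE (negPf eE).
(* The first transposition involves only the face at [c2] and the darts of [e], so the face at [c1]
   still does not reach [e], and the second transposition merges too. *)
have sub : porbit s2 (flip c1) \subset porbit (face_perm rho) (flip c1).
  by apply: porbit_tperm_avoid; rewrite ?out // porbit_sym.
have := @porbits_tperm_merge _ s2 (flip c1) (e, ~~ s).
rewrite -fE porbit_sym (contra (subsetP sub _) (out _)).
by move/(_ isT); lia.
Qed.

End Insert.

(** [<= 1] instead of [= 1] admits the empty edge set, which has no face and from which trees are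
    grown. *)
Definition one_face ES :=
  exists2 rho, rotation_on (darts ES) rho & nfaces ES rho <= 1.

Definition covered ES v := exists2 d, d \in darts ES & head d = v.

(* The first edge cuts the face into two, one on each side of it; the second
   edge can start on either side of the first, hence in the face that does not
   contain its other end. *)
Lemma one_face_add_pair ES e e' s s' : one_face ES ->
  e \notin ES -> e' \notin ES -> e != e' ->
  head ((e, s) : dart G) = head ((e', s') : dart G) ->
  (forall b, covered ES (head ((e, b) : dart G))) ->
  (forall b, covered ES (head ((e', b) : dart G))) ->
  one_face (e' |: (e |: ES)).
Proof.
case=> rho rot nf eE eE' ee hs cov cov'.
have [c1 c1E hc1] := cov s; have [c2 c2E hc2] := cov (~~ s).
have [c2' c2E' hc2'] := cov' (~~ s').
have [nf2 sep] := insert_edge_split rot eE c1E c2E hc1 hc2 nf.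
have rot2 := rotation_insert_edge rot eE c1E c2E hc1 hc2.
move: rot2 nf2 sep; set rho2 := insert_edge _ _ _ _ _ => rot2 nf2 sep.
have e'2 : e' \notin e |: ES by rewrite !inE negb_or eq_sym ee eE'.
have [c [cE hc cc]] : exists c, [/\ c \in darts (e |: ES), head c = head ((e', s') : dart G)
    & flip c \notin porbit (face_perm rho2) (flip c2')].
  have [same|diff] := boolP ((e, s) \in porbit (face_perm rho2) (flip c2')); last first.
    exists c1; split; rewrite ?hc1 //; first by rewrite !inE in c1E *; rewrite c1E orbT.
    rewrite -porbit_step face_permE flipK.
    suff -> : rho2 c1 = (e, s) by [].
    rewrite permM tpermL permM tpermD ?(rotation_fix rot) ?inE //.
      by apply: contraNneq eE => h; rewrite h inE in c2E.
    by rewrite xpair_eqE eqxx; case: (s).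
  exists (e, s); split; rewrite ?hs ?inE ?eqxx //.
  rewrite porbit_sym in same; apply: contra sep => es.
  by rewrite porbit_sym; apply: porbit_trans es same.
have c2E2 : c2' \in darts (e |: ES) by rewrite !inE in c2E' *; rewrite c2E' orbT.
exists (insert_edge rho2 e' s' c c2').
  exact: rotation_insert_edge.
by have := insert_edge_merge rot2 e'2 cE c2E2 hc hc2' cc; rewrite nf2; lia.
Qed.

(** The far end carries no dart yet, so the new dart there is a cycle of its own and a single
    transposition suffices. It absorbs the cycle of the absent edge, and the number of faces stays
    the same. *)
Lemma one_face_add_leaf ES e s : one_face ES -> e \notin ES ->
  covered ES (head ((e, s) : dart G)) ->
  (forall c, c \in darts ES -> head c != head ((e, ~~ s) : dart G)) ->
  one_face (e |: ES).
Proof.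
case=> rho rot nf eE [c cE hc] iso.
have rot1 : rotation_on ((e, ~~ s) |: darts ES) rho.
  by apply: rotation_insert_isolated; rewrite ?inE.
have rot2 : rotation_on (darts (e |: ES)) (tperm c (e, s) * rho)%g.
  rewrite (darts_setU1b e s); apply: rotation_insert => //.
    by rewrite !inE /= !xpair_eqE eqxx (negPf eE) orbF; case: (s).
  by rewrite in_setU1 cE orbT.
pose rho' : {perm dart G} := (tperm c (e, s) * rho)%g.
exists rho'; first exact: rot2.
rewrite -/rho' in rot2.
have := card_porbits_face rot; have := card_porbits_face rot2.
have -> : face_perm rho' = (tperm (flip c) (e, ~~ s) * face_perm rho)%g := face_perm_tperm _ _ _.
have := @porbits_tperm_merge _ (face_perm rho) (flip c) (e, ~~ s).
have -> : flip c \notin porbit (face_perm rho) (e, ~~ s).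
  by apply/negP=> /(face_porbit_darts rot); rewrite flip_darts cE !inE (negPf eE).
move=> m; have {m} := m isT.
have := cardsC ES; have := cardsC (e |: ES); rewrite cardsU1 eE.
by move: nf; lia.
Qed.

(** The first edge of a tree has no dart at either end to be inserted next to, so it is embedded
    separately, by the identity rotation. *)
Lemma one_face_set1 e : (ends e).1 != (ends e).2 -> one_face [set e].
Proof.
move=> nl; have rot : rotation_on (darts [set e]) 1%g.
  split=> [d _|d|]; rewrite ?perm1 // => -[e1 b1] [e2 b2]; rewrite !inE /=.
  move/eqP=> -> /eqP->; rewrite /head.
  case: b1 b2 => [] [] /= h; rewrite ?porbit_id //; move: nl; rewrite h ?eqxx //.
exists 1%g => //; rewrite nfacesE -(cards1 (porbit (face_perm 1) (e, false))).
apply: subset_leq_card; apply/subsetP=> A /imsetP[[e' b]]; rewrite !inE /= => /eqP-> ->.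
rewrite eq_porbit_mem; case: b; last exact: porbit_id.
have -> : (e, true) = face_perm (1%g : {perm dart G}) (e, false).
  by rewrite face_permE perm1.
by rewrite porbit_step porbit_id.
Qed.

(** The last clause separates the start, a single vertex without darts, from all later stages, where
    every vertex offers a dart for the next insertion. *)
Definition partial_tree (T : {set edge G}) (W : {set vert G}) (S : {set edge G}) :=
  [/\ S \subset T, connectedb W S, (forall d, d \in darts S -> head d \in W),
      one_face S & S = set0 /\ #|W| = 1 \/ forall v, v \in W -> covered S v].

Lemma partial_tree_grow VS (T : {set edge G}) W S u v : connectedb VS T ->
  partial_tree T W S -> u \in VS -> v \in VS -> u \in W -> v \notin W ->
  exists W', exists S', [/\ partial_tree T W' S', W \proper W' & W' \subset VS :|: W].
Proof.
move=> con [ST conW SW oneS dich] uV vV uW vW.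
have [[e s] [eT hW hV hV' hW']] := connected_crossing con uV vV uW vW.
rewrite inE /= in eT; rewrite /flip /= in hV' hW'.
set w := head (e, ~~ s) in hV' hW'; set x := head (e, s) in hW hV.
have eS : e \notin S.
  by apply: contra hW' => eS; apply: SW; rewrite inE.
exists (w |: W), (e |: S); split.
- split.
  + by apply/subsetP=> z; rewrite !inE => /orP[/eqP->|/(subsetP ST)].
  + apply: (connectedb_root (r := x)); first by rewrite inE hW orbT.
    move=> z; rewrite !inE => /orP[/eqP->|zW].
      apply/connect1/sub_adjP; rewrite !inE eqxx hW orbT; split=> //.
      by exists (e, s); split=> //; rewrite !inE eqxx.
    apply: (@sub_adj_mono _ W S); rewrite ?subsetUr //.
    exact: connectedb_connect.
  + move=> d; rewrite !inE => /orP[/eqP|] dE; last by rewrite SW ?orbT // inE.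
    case: d dE => e' s' /= ->; have [->|ns] := eqVneq s' s; first by rewrite hW orbT.
    suff -> : s' = ~~ s by rewrite /w eqxx.
    by move: ns; case: s'; case: (s).
  + case: dich => [[S0 _]|cov].
      rewrite S0 setU0; apply: one_face_set1.
      apply: contraNneq hW' => E; have xw : x = w.
        by rewrite /x /w /head /=; case: (s); rewrite /= E.
      by move: hW; rewrite xw.
    apply: (@one_face_add_leaf _ e s) => //; first exact: cov.
    by move=> c cS; apply: contraNneq hW' => E; rewrite /w -E SW.
  + right=> z; rewrite !inE => /orP[/eqP->|zW].
      by exists (e, ~~ s); rewrite ?inE /= ?inE ?eqxx.
    case: dich => [[_ /eqP/cards1P[y Wy]]|cov].
      move: zW hW; rewrite Wy !inE => /eqP-> /eqP xy.
      by exists (e, s); rewrite ?inE /= ?inE ?eqxx.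
    by have [d dS hd] := cov _ zW; exists d => //; rewrite !inE in dS *; rewrite dS orbT.
- by apply/properP; split; [exact: subsetUr | exists w; rewrite ?inE ?eqxx].
- by apply/subsetP=> z; rewrite !inE => /orP[/eqP->|->]; rewrite ?hV' ?orbT.
Qed.

Lemma connected_partial_tree VS (T : {set edge G}) : connectedb VS T ->
  exists S, partial_tree T VS S.
Proof.
move=> con; have [r rV] := connectedb_neq0 con.
suff H n (W : {set vert G}) S : #|VS| - #|W| = n -> r \in W -> W \subset VS -> partial_tree T W S ->
    exists S, partial_tree T VS S.
  apply: (H _ [set r] set0 erefl); rewrite ?inE ?sub1set //; split.
  - exact: sub0set.
  - by apply: (connectedb_root (r := r)); rewrite ?inE // => v; rewrite inE => /eqP->.
  - by move=> d; rewrite !inE.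
  - exists 1%g; first exact: rotation_set0.
    rewrite nfacesE (_ : darts _ = set0) ?imset0 ?cards0 //.
    by apply/setP => d; rewrite !inE.
  - by left; rewrite cards1.
elim/ltn_ind: n W S => n IH W S nE rW WV pt.
have [VW|/subsetPn[v vV vW]] := boolP (VS \subset W).
  by exists S; have <- : W = VS by apply/eqP; rewrite eqEsubset WV.
have [W' [S' [pt' lt WV']]] := partial_tree_grow con pt rV vV rW vW.
have WV2 : W' \subset VS by rewrite (subset_trans WV') // subUset subxx.
apply: (IH (#|VS| - #|W'|) _ W' S') => //.
- by have := proper_card lt; have := subset_leq_card WV2; lia.
- by rewrite (subsetP (proper_sub lt)).
Qed.

(** A tree [S] grown inside [T] connects all of [VS]; as every edge of [T] is a bridge, [S] is all
    of [T]. *)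
Lemma spanning_tree_one_face VS ES T : spanning_tree VS ES T -> one_face T.
Proof.
case/and3P=> _ con /forallP minT.
have [S [ST conS _ oneS _]] := connected_partial_tree con.
suff -> : T = S by [].
apply/eqP; rewrite eqEsubset ST andbT; apply/subsetP=> e eT; apply/negPn/negP => eS.
have := minT e; rewrite eT /= => /negP[]; apply: connectedb_mono conS.
by apply/subsetP=> z zS; rewrite !inE (subsetP ST) // andbT; apply: contraNneq eS => <-.
Qed.

End EdgeInsertion.

(** * Even cotrees *)

Lemma odd_card_addb (T : finType) (K : {set T}) (p : pred T) :
  odd #|[set w in K | p w]| = \big[addb/false]_(w in K) p w.
Proof.
have -> : #|[set w in K | p w]| = \sum_(w in K) p w.
  rewrite -sum1_card big_mkcond [RHS]big_mkcond; apply: eq_bigr => w _.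
  by rewrite inE; case: (w \in K) => //=; case: (p w).
by rewrite (big_morph odd oddD erefl); apply: eq_bigr => w _; rewrite oddb.
Qed.

Section EvenAssignment.
Variable G : graph.
Implicit Types (C S : {set edge G}) (t : pred (vert G)) (a : {ffun edge G -> bool}).

(** [a] assigns every edge to one of its ends. If each vertex receives an even number of edges, they
    can be grouped into pairs with a common end. *)
Definition target a (e : edge G) : vert G := head ((e, a e) : dart G).

Definition load C a v := #|[set e in C | target a e == v]|.

Lemma loadD1 C a e v : e \in C -> load C a v = (target a e == v) + load (C :\ e) a v.
Proof.
move=> eC; rewrite /load (cardsD1 e) !inE eC /=; congr (_ + _).
by apply: eq_card => z; rewrite !inE andbA.
Qed.

(** Moving a single edge from one end to the other changes the parity at both; for a loop the two
    changes cancel. *)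
Lemma load_switch C a u v : sub_adj [set: vert G] C u v ->
  exists a', forall w, odd (load C a' w) = odd (load C a w) (+) (w == u) (+) (w == v).
Proof.
case/sub_adjP=> _ _ [[e s] [eC hu hv]]; rewrite inE /= in eC.
exists [ffun z => if z == e then ~~ a e else a z] => w.
rewrite !(loadD1 _ _ eC) /target ffunE eqxx.
set R := load _ _ _; set R' := load _ _ _; have -> : R = R'.
  apply: eq_card => z; rewrite !inE /target ffunE.
  by case: (z =P e).
rewrite !oddD -hu -hv ![w == _]eq_sym /flip /=.
by case: (a e); case: s {hu hv} => /=; rewrite !oddb;
  case: (head (e, true) == w); case: (head (e, false) == w); case: (odd R').
Qed.

Lemma load_switch_connect C a u v : connect (sub_adj [set: vert G] C) u v ->
  exists a', forall w, odd (load C a' w) = odd (load C a w) (+) (w == u) (+) (w == v).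
Proof.
case/connectP=> p; elim: p u a => [|z p IH] u a /=.
  by move=> _ ->; exists a => w; rewrite addbK.
case/andP=> /(load_switch a)[a1 a1E] zp vE.
have [a2 a2E] := IH z a1 zp vE; exists a2 => w; rewrite a2E a1E.
by case: (w == z); case: (w == u); case: (w == v); case: (odd _).
Qed.

(** Both ends of an edge of [C] lie in the same component, so testing the end chosen by [a] is
    enough. *)
Lemma comp_edges_target C a v :
  comp_edges C (comp [set: vert G] C v) =
  [set e in C | target a e \in comp [set: vert G] C v].
Proof.
apply/setP=> e; rewrite !inE; have [eC|//] := boolP (e \in C); rewrite /target /head /=.
have adj : connect (sub_adj [set: vert G] C) v (ends e).1 =
           connect (sub_adj [set: vert G] C) v (ends e).2.
  apply: (same_connect_r (@connect_sub_adj_sym _ _ _)); apply/connect1/sub_adjP.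
  by rewrite !inE; split=> //; exists (e, false); rewrite inE.
by case: (a e) => /=; rewrite adj andbb.
Qed.

Lemma sum_load C a v :
  #|comp_edges C (comp [set: vert G] C v)| =
  \sum_(w in comp [set: vert G] C v) load C a w.
Proof.
rewrite (comp_edges_target C a) -sum1_card.
rewrite (partition_big (target a) (mem (comp [set: vert G] C v))) /=; last first.
  by move=> e; rewrite inE => /andP[].
apply: eq_bigr => w wK; rewrite /load -sum1_card; apply: eq_bigl => e; rewrite !inE.
move: wK; rewrite !inE /= => wK.
by case: eqP => [->|_]; rewrite ?andbF // wK !andbT.
Qed.

(** [t] prescribes the parities. Each component has an even number of vertices with wrong parity, so
    a wrong vertex has a wrong partner there, and switching along a path between them repairs
    both. *)
Lemma exists_assignment C t :
  (forall v, let K := comp [set: vert G] C v in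
     odd #|comp_edges C K| = odd #|[set w in K | t w]|) ->
  exists a, forall v, odd (load C a v) = t v.
Proof.
move=> even; pose bad a := [set v | odd (load C a v) (+) t v].
suff H n a : #|bad a| = n -> exists a, forall v, odd (load C a v) = t v.
  exact: (H _ [ffun=> false] erefl).
elim/ltn_ind: n a => n IH a nE.
have [bad0|[v vbad]] := set_0Vmem (bad a).
  exists a => v; have : v \notin bad a by rewrite bad0 inE.
  by rewrite inE; case: (odd _); case: (t v).
pose K := comp [set: vert G] C v.
have vK : v \in K by rewrite !inE connect0.
have oddK : ~~ odd #|[set w in K | w \in bad a]|.
  rewrite odd_card_addb.
  under eq_bigr do rewrite inE.
  rewrite big_split /= -!odd_card_addb -even /K (sum_load C a v) odd_card_addb.
  by rewrite (big_morph odd oddD erefl) addbb.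
have [w /andP[wv] wKb] : exists w, (w != v) && (w \in [set w in K | w \in bad a]).
  move: oddK; rewrite (cardsD1 v) [v \in _]inE vK vbad oddD /= negbK.
  move/odd_gt0/card_gt0P=> [w].
  by rewrite in_setD1; exists w.
move: wKb; rewrite inE => /andP[wK wbad].
have [|a' a'E] := @load_switch_connect C a v w; first by move: wK; rewrite !inE.
apply: (IH #|bad a'| _ a') => //.
have sub : bad a' \subset bad a :\ v :\ w.
  apply/subsetP=> z; rewrite !inE a'E.
  have [->|_] := eqVneq z w; rewrite /= ?(negPf wv).
    by move: wbad; rewrite inE; case: (odd _); case: (t w).
  have [->|_] := eqVneq z v; rewrite /= ?addbF //.
  by move: vbad; rewrite inE; case: (odd _); case: (t v).
rewrite -nE (cardsD1 v (bad a)) vbad; apply: leq_ltn_trans (subset_leq_card sub) _.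
by rewrite ltnS; apply/subset_leq_card/subD1set.
Qed.

(** A vertex that receives one edge receives a second one. The two are adjacent, so they can be
    added together, and removing them from [C] keeps all loads even. *)
Lemma one_face_add_even C S a : one_face S -> [disjoint C & S] ->
  (forall v, covered S v) -> (forall v, ~~ odd (load C a v)) -> one_face (C :|: S).
Proof.
move=> oneS; move: {2}#|C| (erefl #|C|) => n; elim/ltn_ind: n C => n IH C nE dis cov ev.
have [->|[e eC]] := set_0Vmem C; first by rewrite set0U.
have [e' /andP[ee eC']] : exists e', (e' != e) &&
    (e' \in [set z in C | target a z == target a e]).
  have := ev (target a e); rewrite (loadD1 _ _ eC) eqxx oddD /= negbK.
  move/odd_gt0/card_gt0P=> [z].
  by rewrite !inE -andbA => zE; exists z; rewrite !inE.
move: eC'; rewrite inE => /andP[eC' /eqP te].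
have eC2 : e' \in C :\ e by rewrite !inE ee.
pose C' := C :\ e :\ e'.
have disS z : z \in C -> z \notin S by move=> zC; rewrite (disjointFr dis).
have CE : C :|: S = e' |: (e |: (C' :|: S)).
  apply/setP=> z; rewrite !inE; have [->|] := eqVneq z e'; first by rewrite eC'.
  by have [->|//] := eqVneq z e; rewrite eC.
have covU d : covered (C' :|: S) d.
  by have [z zS <-] := cov d; exists z => //; rewrite !inE in zS *; rewrite zS orbT.
rewrite CE; apply: (@one_face_add_pair _ _ _ _ (a e) (a e')) => //.
- apply: (IH #|C'|) => //.
  + by rewrite -nE (cardsD1 e C) eC (cardsD1 e' (C :\ e)) eC2 -/C' add1n ltnS leq_addl.
  + apply: disjointWl dis; rewrite !subDset; apply/subsetP => z.
    by rewrite !inE => ->; rewrite !orbT.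
  + move=> v; have := ev v; rewrite (loadD1 _ _ eC) (loadD1 _ _ eC2) te.
    by rewrite addnA addnn oddD odd_double.
- by rewrite !inE eqxx /= andbF /= disS.
- by rewrite !inE eqxx /= disS.
- by rewrite eq_sym.
Qed.

(** Odd load is prescribed at one end [u] of [e] only. As [e] is alone in its cotree component, it
    is assigned to [u], so the other cotree edges have even loads. Hence [G - e] has a one-face
    embedding, whose face is cut in two by [e]. *)
Lemma odd_edge_two_faces (e : edge G) : 2 <= #|vert G| -> odd_edge e ->
  exists rho, [/\ rotation_on (darts [set: edge G]) rho, nfaces [set: edge G] rho = 2
    & (e, false) \notin porbit (face_perm rho) (e, true)].
Proof.
move=> V2 [_ [T [/andP[tree _] eT oc ce]]].
have oneT := spanning_tree_one_face tree.
have covT v : covered T v.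
  case/and3P: tree => _ con _.
  by apply: (connected_has_dart con); rewrite ?inE ?cardsT.
pose D := [set: edge G] :\: T; pose u := (ends e).1.
have eD : e \in D by rewrite !inE eT.
(* The parities fit: the component of [u] is the only odd one. *)
have [v /=|a aE] := @exists_assignment D (pred1 u).
  have Kv : odd #|comp_edges D (comp [set: vert G] D v)| =
            (comp [set: vert G] D v \in odd_comps [set: vert G] [set: edge G] T).
    by rewrite inE imset_f ?inE.
  rewrite Kv oc inE -/D -/u odd_card_addb.
  have [uK|uK] := boolP (u \in comp [set: vert G] D v).
    rewrite (bigD1 u) //= eqxx big1 => [|z /andP[_ /negPf//]].
    rewrite addbF; apply/eqP/setP=> z; rewrite !inE.
    by move: uK; rewrite !inE => vu; exact: (same_connect (@connect_sub_adj_sym _ _ _) vu).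
  rewrite big1 => [|z zK]; last by apply: contraNF uK => /eqP<-.
  apply: contraNF uK => /eqP->; rewrite !inE; exact: connect0.
have au : target a e = u.
  have : odd (load D a u) by rewrite aE /= eqxx.
  move/odd_gt0/card_gt0P=> [z].
  rewrite inE => /andP[zD /eqP zu]; suff : z \in [set e] by rewrite inE => /eqP <-.
  rewrite -ce -/D (comp_edges_target D a) inE zD zu !inE; exact: connect0.
pose C := D :\ e.
have : one_face (C :|: T).
  apply: (@one_face_add_even C T a) => //.
    by rewrite -setI_eq0; apply/eqP/setP=> z; rewrite !inE; case: (z \in T); rewrite ?andbF.
  move=> v; have := aE v; rewrite (loadD1 _ _ eD) au oddD /= oddb eq_sym /C.
  by case: (v == u); case: (odd _).
have -> : C :|: T = [set: edge G] :\ e.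
  apply/setP=> z; rewrite !inE andbT; have [->|_] := eqVneq z e; first by rewrite (negPf eT).
  by case: (z \in T).
have eS : e \notin [set: edge G] :\ e by rewrite !inE eqxx.
have covS v : covered ([set: edge G] :\ e) v.
  have [d dT <-] := covT v; exists d => //; move: dT; rewrite !inE andbT.
  by apply: contraTneq => ->.
case=> rho rot nf; have [c1 c1E h1] := covS (head ((e, false) : dart G)).
have [c2 c2E h2] := covS (head ((e, true) : dart G)).
have := @insert_edge_split _ _ rho e false c1 c2 rot eS c1E c2E h1 h2 nf.
have := @rotation_insert_edge _ _ rho e false c1 c2 rot eS c1E c2E h1 h2.
by rewrite setD1K ?inE // => rot' [nf' sep]; exists (insert_edge rho e false c1 c2).
Qed.

End EvenAssignment.

(** * Two-sums of graphs *)

(* The darts of the sum are those of the two summands; only the reversal of the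
   darts of [e1] and [e2] is changed: it exchanges them crosswise.  This
   description, unlike [sum2], is symmetric in the two summands. *)
Record dart_sum (G1 G2 G : graph) (e1 : edge G1) (e2 : edge G2)
    (v1 : vert G1 -> vert G) (v2 : vert G2 -> vert G)
    (i1 : dart G1 -> dart G) (i2 : dart G2 -> dart G) (c : bool) : Prop := DartSum {
  dsv1_inj : injective v1;
  dsv2_inj : injective v2;
  dsv_disj : forall x y, v1 x != v2 y;
  dsv_cover : forall z, (exists x, z = v1 x) \/ (exists y, z = v2 y);
  dsi1_inj : injective i1;
  dsi2_inj : injective i2;
  dsi_disj : forall x y, i1 x != i2 y;
  dsi_cover : forall z, (exists x, z = i1 x) \/ (exists y, z = i2 y);
  ds_head1 : forall d, head (i1 d) = v1 (head d);
  ds_head2 : forall d, head (i2 d) = v2 (head d);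
  ds_flip1 : forall d, d.1 != e1 -> flip (i1 d) = i1 (flip d);
  ds_flip2 : forall d, d.1 != e2 -> flip (i2 d) = i2 (flip d);
  ds_flip_cross : forall s, flip (i1 (e1, s)) = i2 (e2, s (+) c) }.

Lemma dart_sum_sym G1 G2 G e1 e2 v1 v2 i1 i2 c :
  @dart_sum G1 G2 G e1 e2 v1 v2 i1 i2 c -> @dart_sum G2 G1 G e2 e1 v2 v1 i2 i1 c.
Proof.
case=> vi1 vi2 vd vc ii1 ii2 id ic h1 h2 f1 f2 fx; split=> //.
- by move=> x y; rewrite eq_sym.
- by move=> z; case: (vc z); [right|left].
- by move=> x y; rewrite eq_sym.
- by move=> z; case: (ic z); [right|left].
- by move=> s; rewrite -[s in LHS](addbK c) -fx flipK.
Qed.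

Section DartSum.
Variables (G1 G2 G : graph) (e1 : edge G1) (e2 : edge G2).
Variables (v1 : vert G1 -> vert G) (v2 : vert G2 -> vert G).
Variables (i1 : dart G1 -> dart G) (i2 : dart G2 -> dart G) (c : bool).
Hypothesis ds : dart_sum e1 e2 v1 v2 i1 i2 c.

(** A new edge consists of a dart of [e1] and a dart of [e2], so such a splitting exists only if the
    two new edges are both present in [ES] or both absent. *)
Definition splits (ES : {set edge G}) (A1 : {set edge G1}) (A2 : {set edge G2}) :=
  (forall d, (i1 d \in darts ES) = (d \in darts A1)) /\
  (forall d, (i2 d \in darts ES) = (d \in darts A2)).

(** The count goes through darts, because a new edge belongs half to each summand. *)
Lemma card_splits ES A1 A2 : splits ES A1 A2 -> #|ES| = #|A1| + #|A2|.
Proof.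
case=> s1 s2; apply: double_inj; rewrite doubleD -!card_darts.
have -> : darts ES = i1 @: darts A1 :|: i2 @: darts A2.
  apply/setP=> z; rewrite in_setU; case: (dsi_cover ds z) => -[x ->].
    rewrite s1 (mem_imset _ _ (dsi1_inj ds)); case: imsetP => [[y _ h]|_]; last by rewrite orbF.
    by have := dsi_disj ds x y; rewrite h eqxx.
  rewrite s2 (mem_imset _ _ (dsi2_inj ds)); case: imsetP => [[y _ h]|//].
  by have := dsi_disj ds y x; rewrite h eqxx.
rewrite cardsU disjoint_setI0 ?cards0 ?subn0.
  by rewrite (card_imset _ (dsi1_inj ds)) (card_imset _ (dsi2_inj ds)).
apply/pred0P => z /=; apply/negP => /andP[/imsetP[x _ ->] /imsetP[y _ h]].
by have := dsi_disj ds x y; rewrite h eqxx.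
Qed.

Lemma splitsC ES A1 A2 : splits ES A1 A2 -> splits (~: ES) (~: A1) (~: A2).
Proof. by case=> s1 s2; split=> d; [have := s1 d|have := s2 d]; rewrite !inE => ->. Qed.

Definition acts_as (rho : {perm dart G}) (rho1 : {perm dart G1}) (rho2 : {perm dart G2}) :=
  (forall d, rho (i1 d) = i1 (rho1 d)) /\ (forall d, rho (i2 d) = i2 (rho2 d)).

Lemma split_rotation ES A1 A2 rho : splits ES A1 A2 -> rotation_on (darts ES) rho ->
  exists rho1 rho2, [/\ acts_as rho rho1 rho2,
    rotation_on (darts A1) rho1 & rotation_on (darts A2) rho2].
Proof.
move=> [s1 s2] [fixE hdE cyc].
have [x|rho1 r1] := perm_restrict (i := i1) (t := rho) (dsi1_inj ds).
  have := hdE (i1 x); case: (dsi_cover ds (rho (i1 x))) => -[y ->]; first by exists y.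
  rewrite (ds_head1 ds) (ds_head2 ds) => h.
  by have := dsv_disj ds (head x) (head y); rewrite h eqxx.
have [x|rho2 r2] := perm_restrict (i := i2) (t := rho) (dsi2_inj ds).
  have := hdE (i2 x); case: (dsi_cover ds (rho (i2 x))) => -[y ->]; last by exists y.
  rewrite (ds_head1 ds) (ds_head2 ds) => h.
  by have := dsv_disj ds (head y) (head x); rewrite h eqxx.
exists rho1, rho2; split=> //; split.
- by move=> d dA; apply: (dsi1_inj ds); rewrite -r1 fixE // s1.
- by move=> d; apply: (dsv1_inj ds); rewrite -!(ds_head1 ds) -r1.
- move=> d d' dA dA' hd; have := cyc (i1 d) (i1 d'); rewrite !s1 !(ds_head1 ds) hd.
  move=> /(_ dA dA' erefl); rewrite (porbit_image _ r1).
  by rewrite (mem_imset _ _ (dsi1_inj ds)).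
- by move=> d dA; apply: (dsi2_inj ds); rewrite -r2 fixE // s2.
- by move=> d; apply: (dsv2_inj ds); rewrite -!(ds_head2 ds) -r2.
- move=> d d' dA dA' hd; have := cyc (i2 d) (i2 d'); rewrite !s2 !(ds_head2 ds) hd.
  move=> /(_ dA dA' erefl); rewrite (porbit_image _ r2).
  by rewrite (mem_imset _ _ (dsi2_inj ds)).
Qed.

Lemma glue_rotation ES A1 A2 rho1 rho2 : splits ES A1 A2 ->
  rotation_on (darts A1) rho1 -> rotation_on (darts A2) rho2 ->
  exists2 rho, acts_as rho rho1 rho2 & rotation_on (darts ES) rho.
Proof.
move=> [s1 s2] [fix1 hd1 cyc1] [fix2 hd2 cyc2].
have [rho [r1 r2]] := perm_glue (dsi1_inj ds) (dsi2_inj ds) (dsi_disj ds) (dsi_cover ds)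
  rho1 rho2.
exists rho; split=> // z; case: (dsi_cover ds z) => -[d ->].
- by rewrite s1 r1 => /fix1->.
- by rewrite s2 r2 => /fix2->.
- by rewrite r1 !(ds_head1 ds) hd1.
- by rewrite r2 !(ds_head2 ds) hd2.
- move=> z'; case: (dsi_cover ds z') => -[d' ->]; rewrite !(ds_head1 ds) ?(ds_head2 ds).
    rewrite !s1 (porbit_image _ r1) (mem_imset _ _ (dsi1_inj ds)) => dA dA'.
    by move/(dsv1_inj ds); exact: cyc1.
  by move=> _ _ h; have := dsv_disj ds (head d) (head d'); rewrite h eqxx.
- move=> z'; case: (dsi_cover ds z') => -[d' ->]; rewrite ?(ds_head1 ds) !(ds_head2 ds).
    by move=> _ _ h; have := dsv_disj ds (head d') (head d); rewrite h eqxx.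
  rewrite !s2 (porbit_image _ r2) (mem_imset _ _ (dsi2_inj ds)) => dA dA'.
  by move/(dsv2_inj ds); exact: cyc2.
Qed.

(** * The face permutation of a two-sum *)

Let x := i1 (e1, false).
Let y := i1 (e1, true).

(** Undoes the crosswise reversal: this is the face permutation of the disjoint union of [G1] and
    [G2], carried over to the darts of the sum. *)
Definition uncross (rho : {perm dart G}) : {perm dart G} :=
  (tperm (flip y) x * (tperm (flip x) y * face_perm rho))%g.

Lemma uncrossK rho :
  face_perm rho = (tperm (flip x) y * (tperm (flip y) x * uncross rho))%g.
Proof.
rewrite /uncross [(tperm (flip y) x * (tperm (flip y) x * _))%g]mulgA tperm2 mul1g.
by rewrite mulgA tperm2 mul1g.
Qed.

Let nxy : x != y.
Proof. by apply/eqP => /(dsi1_inj ds). Qed.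
Let flipxE : flip x = i2 (e2, c). Proof. exact: (ds_flip_cross ds). Qed.
Let flipyE : flip y = i2 (e2, ~~ c). Proof. exact: (ds_flip_cross ds). Qed.

Lemma uncross_acts rho rho1 rho2 : acts_as rho rho1 rho2 ->
  (forall d, uncross rho (i1 d) = i1 (face_perm rho1 d)) /\
  (forall d, uncross rho (i2 d) = i2 (face_perm rho2 d)).
Proof.
move=> [r1 r2].
have fxy : flip x != flip y by rewrite (inj_eq (can_inj (@flipK G))).
have x_fy : flip y != x by rewrite flipyE eq_sym (dsi_disj ds).
have y_fx : flip x != y by rewrite flipxE eq_sym (dsi_disj ds).
have x_fx : flip x != x by rewrite flipxE eq_sym (dsi_disj ds).
have y_fy : flip y != y by rewrite flipyE eq_sym (dsi_disj ds).
have ux : uncross rho x = rho y.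
  by rewrite !permM tpermR tpermD // 1?eq_sym // permE flipK.
have uy : uncross rho y = rho x.
  by rewrite permM (tpermD y_fy nxy) permM tpermR face_permE flipK.
have ufx : uncross rho (flip x) = rho (flip y).
  by rewrite permM tpermD 1?eq_sym // permM tpermL face_permE.
have ufy : uncross rho (flip y) = rho (flip x).
  by rewrite permM tpermL permM (tpermD x_fx) 1?eq_sym // face_permE.
have uz z : z != x -> z != y -> z != flip x -> z != flip y ->
    uncross rho z = rho (flip z).
  by move=> zx zy zfx zfy; rewrite permM tpermD 1?eq_sym // permM tpermD 1?eq_sym // face_permE.
split=> d.
  have [|de] := eqVneq d.1 e1.
    by case: d => e [] /= ->; rewrite face_permE -r1 -/x -/y ?ux ?uy.
  have out b : i1 d != i1 (e1, b) by apply: contraNneq de => /(dsi1_inj ds)->.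
  rewrite uz ?out //; try by rewrite ?flipxE ?flipyE (dsi_disj ds).
  by rewrite (ds_flip1 ds) // face_permE r1.
have [|de] := eqVneq d.1 e2.
  case: d => e s /= ->; have [sc|sc] := eqVneq s c.
    by rewrite sc -flipxE ufx flipyE r2 face_permE.
  have -> : s = ~~ c by case: (s) (c) sc => [] [].
  by rewrite -flipyE ufy flipxE r2 face_permE /flip /= negbK.
have out b : i2 d != i2 (e2, b) by apply: contraNneq de => /(dsi2_inj ds)->.
rewrite uz ?flipxE ?flipyE ?out //; try by rewrite eq_sym (dsi_disj ds).
by rewrite (ds_flip2 ds) // face_permE r2.
Qed.

Lemma card_porbits_uncross rho rho1 rho2 : acts_as rho rho1 rho2 ->
  #|porbits (uncross rho)| = #|porbits (face_perm rho1)| + #|porbits (face_perm rho2)|.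
Proof.
case/uncross_acts => u1 u2.
by rewrite (card_porbits_glue (dsi1_inj ds) (dsi2_inj ds) (dsi_disj ds) (dsi_cover ds) u1 u2).
Qed.

Section Faces.
Variables (ES : {set edge G}) (A1 : {set edge G1}) (A2 : {set edge G2}).
Variables (rho : {perm dart G}) (rho1 : {perm dart G1}) (rho2 : {perm dart G2}).
Hypotheses (spl : splits ES A1 A2) (act : acts_as rho rho1 rho2).
Hypotheses (rot : rotation_on (darts ES) rho).
Hypotheses (rot1 : rotation_on (darts A1) rho1) (rot2 : rotation_on (darts A2) rho2).

Let cards : [/\ #|porbits (face_perm rho)| = nfaces ES rho + #|~: ES|,
  #|porbits (uncross rho)| = nfaces A1 rho1 + #|~: A1| + (nfaces A2 rho2 + #|~: A2|) &
  #|~: ES| = #|~: A1| + #|~: A2|].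
Proof.
rewrite (card_porbits_uncross act) (card_porbits_face rot) (card_porbits_face rot1).
by rewrite (card_porbits_face rot2) (card_splits (splitsC spl)).
Qed.

Lemma nfaces_split : nfaces A1 rho1 + nfaces A2 rho2 <= nfaces ES rho + 2.
Proof.
case: cards => c1 c2 c3; pose s : {perm dart G} := (tperm (flip x) y * face_perm rho)%g.
have l1 : #|porbits s| <= #|porbits (face_perm rho)| + 1 := porbits_tperm_le _ _ _.
have l2 : #|porbits (uncross rho)| <= #|porbits s| + 1 := porbits_tperm_le _ _ _.
by lia.
Qed.

(** With both new edges absent, [flip x] and [y] lie on the two-dart cycles of different edges, so
    the first transposition merges and makes up for the second. *)
Lemma nfaces_split_disconnected : e1 \notin A1 ->
  nfaces A1 rho1 + nfaces A2 rho2 <= nfaces ES rho.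
Proof.
move=> eA; case: cards => c1 c2 c3.
pose s : {perm dart G} := (tperm (flip x) y * face_perm rho)%g.
have xs : flip x \notin porbit (face_perm rho) y.
  have : y \notin darts ES by rewrite spl.1 inE.
  rewrite inE (surjective_pairing y) => yE; rewrite (face_porbit_outside _ rot yE) inE /=.
  have fxy : flip x != y by rewrite flipxE eq_sym (dsi_disj ds).
  have := nxy; rewrite (surjective_pairing x) (surjective_pairing y) xpair_eqE negb_and.
  move: fxy; rewrite (surjective_pairing x) (surjective_pairing y) xpair_eqE negb_and /=.
  by case: (x.1 == y.1); case: (x.2); case: (y.2).
have l1 : #|porbits s| + 1 = #|porbits (face_perm rho)| := porbits_tperm_merge xs.
have l2 : #|porbits (uncross rho)| <= #|porbits s| + 1 := porbits_tperm_le _ _ _.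
by lia.
Qed.

(** On the way back from the disjoint union, the first transposition joins a face of [G2] to the
    face of [x]. By hypothesis [y] is on another face, still untouched, so the second transposition
    merges as well and two faces are lost. *)
Lemma nfaces_glue : (e1, false) \notin porbit (face_perm rho1) (e1, true) ->
  nfaces ES rho + 2 = nfaces A1 rho1 + nfaces A2 rho2.
Proof.
move=> sep; case: cards => c1 c2 c3; have [u1 u2] := uncross_acts act.
have side d d' : i2 d' \notin porbit (uncross rho) (i1 d).
  rewrite (porbit_image _ u1); apply/imsetP => -[z _ h].
  by have := dsi_disj ds z d'; rewrite h eqxx.
pose s : {perm dart G} := (tperm (flip y) x * uncross rho)%g.
have l1 : #|porbits s| + 1 = #|porbits (uncross rho)|.
  by apply: porbits_tperm_merge; rewrite flipyE side.
have sub : porbit s y \subset porbit (uncross rho) y.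
  apply: porbit_tperm_avoid; first by rewrite flipyE side.
  by rewrite (porbit_image _ u1) (mem_imset _ _ (dsi1_inj ds)).
have l2 : #|porbits (tperm (flip x) y * s)%g| + 1 = #|porbits s|.
  by apply: porbits_tperm_merge; rewrite (contra (subsetP sub _)) // flipxE side.
have fE : face_perm rho = (tperm (flip x) y * s)%g := uncrossK rho.
by rewrite -fE in l2; lia.
Qed.

End Faces.
End DartSum.

(** * Upper embeddability and face counts *)

Section UpperEmbeddable.
Variable G : graph.
Implicit Types (ES : {set edge G}) (VS : {set vert G}).

Lemma xi_le1 VS ES rho : rotation_on (darts ES) rho ->
  nfaces ES rho <= 1 + odd (beta VS ES) -> xi VS ES <= 1.
Proof.
move=> /is_rotationP rot nf.
have : genus_rot VS ES rho <= max_genus VS ES.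
  exact: leq_bigmax_cond.
rewrite /xi /genus_rot; move: (beta VS ES) nf (max_genus _ _) => b; lia.
Qed.

(** If all embeddings had two or more faces, the genus would be at most [(beta - 1)./2] and, [beta]
    being even, [xi] at least 2. The bound [2 <= beta] counters truncated subtraction: for
    [beta = 0], [xi] vanishes whatever the genus. *)
Lemma xi_le1_one_face VS ES : xi VS ES <= 1 -> ~~ odd (beta VS ES) -> 2 <= beta VS ES ->
  exists2 rho, rotation_on (darts ES) rho & nfaces ES rho <= 1.
Proof.
move=> xi1 ev b2.
have [/existsP[rho /andP[/is_rotationP rot nf]]|noex] :=
  boolP [exists rho, is_rotation ES rho && (nfaces ES rho <= 1)]; first by exists rho.
have : max_genus VS ES <= (beta VS ES - 1)./2.
  apply/bigmax_leqP => rho rot; rewrite /genus_rot.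
  have : 1 < nfaces ES rho.
    by rewrite ltnNge; apply: contraNN noex => nf; apply/existsP; exists rho; rewrite rot.
  by lia.
by move: xi1; rewrite /xi; lia.
Qed.

End UpperEmbeddable.

(** * Cubic graphs *)

Section Cubic.
Variable G : graph.

Definition cubic2 : Prop :=
  [/\ two_connected G, cubicb [set: vert G] [set: edge G] & odd (beta [set: vert G] [set: edge G])].

Hypothesis cub : cubic2.

Lemma cubic_loopless (d : dart G) : head d != head (flip d).
Proof.
case: cub => /and4P[_ _ /forallP/(_ d.1) + _] _ _; rewrite inE /= /head /flip /=.
by case: d => e [] /=; rewrite // eq_sym.
Qed.

Lemma cubic_card_darts_at v : #|[set d : dart G | head d == v]| = 3.
Proof.
case: cub => _ /forallP/(_ v); rewrite inE /= => /eqP <- _.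
by apply: eq_card => d; rewrite !inE.
Qed.

Lemma cubic_handshake : #|edge G|.*2 = 3 * #|vert G|.
Proof.
have <- : #|{: dart G}| = #|edge G|.*2 by rewrite card_prod card_bool muln2.
rewrite -sum1_card (partition_big (@head G) predT) //= mulnC -sum_nat_const.
apply: eq_bigr => v _; rewrite -(cubic_card_darts_at v) -sum1_card.
by apply: eq_bigl => d; rewrite inE.
Qed.

(** [|V| = 2n] and [|E| = 3n] give [beta = n + 1], so [n] is even, and it is positive. *)
Lemma cubic_card_vert : 4 <= #|vert G|.
Proof.
have := cubic_handshake; case: cub => /and4P[_ + _ _] _; rewrite /beta !cardsT.
by lia.
Qed.

Lemma cubic_beta : odd (#|edge G| + 1 - #|vert G|).
Proof. by case: cub => _ _; rewrite /beta !cardsT. Qed.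

Lemma cubic_connected : connectedb [set: vert G] [set: edge G].
Proof. by case: cub => /and4P[]. Qed.

Lemma cubic_del_vertex v :
  connectedb ([set: vert G] :\ v) [set e in [set: edge G] | ~~ incident e v].
Proof. by case: cub => /and4P[_ _ _ /forallP/(_ v)]; rewrite inE. Qed.

Lemma cubic_covered v : exists2 d : dart G, d \in darts [set: edge G] & head d = v.
Proof.
have /card_gt0P[d] : 0 < #|[set d : dart G | head d == v]|.
  by rewrite cubic_card_darts_at.
by rewrite inE => /eqP; exists d; rewrite ?inE.
Qed.

Lemma card_incident v : #|[set e : edge G | incident e v]| = 3.
Proof.
rewrite -(cubic_card_darts_at v).
have -> : [set e : edge G | incident e v] = [set d.1 | d in [set d : dart G | head d == v]].
  apply/setP=> e; rewrite inE; apply/incidentP/imsetP => [[s h]|[[e' s] + ->]].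
    by exists (e, s); rewrite ?inE ?h.
  by rewrite inE => /eqP; exists s.
apply: card_in_imset => -[e s] [e' s']; rewrite !inE => /eqP h /eqP h' /= ee.
rewrite -ee in h' *; have := cubic_loopless (e, s); rewrite h /flip /=.
by case: s s' h h' => [] [] //= _ <-; rewrite eqxx.
Qed.

Lemma card_not_incident v :
  #|[set e in [set: edge G] | ~~ incident e v]| + 3 = #|edge G|.
Proof.
rewrite -(card_incident v) -(cardsC [set e : edge G | incident e v]) addnC.
by congr (_ + _); apply: eq_card => e; rewrite !inE.
Qed.

Lemma incident_joins (e : edge G) x y : x != y ->
  (incident e x && incident e y) = joins e x y.
Proof.
move=> xy; apply/andP/joinsP => [[/incidentP[s hx] /incidentP[s' hy]]|[s [hx hy]]].
  exists s; split=> //; suff <- : s' = ~~ s by [].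
  by case: s s' hx hy => [] [] // h h'; move: xy; rewrite -h -h' eqxx.
by split; apply/incidentP; [exists s | exists (~~ s)].
Qed.

Lemma card_del2E x y : x != y -> #|[set e in [set: edge G] | joins e x y]| = 1 ->
  #|del2E [set: edge G] x y| + 5 = #|edge G|.
Proof.
move=> xy j1; rewrite -(cardsC [set e : edge G | incident e x || incident e y]) addnC.
congr (_ + _); last by apply: eq_card => e; rewrite !inE negb_or.
have := cardsUI [set e : edge G | incident e x] [set e : edge G | incident e y].
rewrite !card_incident.
have -> : [set e : edge G | incident e x] :|: [set e : edge G | incident e y]
  = [set e : edge G | incident e x || incident e y] by apply/setP=> e; rewrite !inE.
have -> : [set e : edge G | incident e x] :&: [set e : edge G | incident e y]
  = [set e in [set: edge G] | joins e x y].
  by apply/setP=> e; rewrite !inE incident_joins.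
by rewrite j1; lia.
Qed.

Lemma card_del2V x y : x != y -> #|del2V [set: vert G] x y| + 2 = #|vert G|.
Proof.
move=> xy; rewrite /del2V setTD -(cardsC [set x; y]) cards2 xy addnC //.
Qed.

(** An end [u] of [e] has three darts and [e] carries only two, so another edge at [u] leads into
    [G - u], which is connected and avoids [e]. *)
Lemma cubic_not_bridge e : connectedb [set: vert G] ([set: edge G] :\ e).
Proof.
pose u := head ((e, false) : dart G).
have [d /andP[du de]] : exists d : dart G, (head d == u) && (d.1 != e).
  apply/existsP; apply: contraTT isT; rewrite negb_exists => /forallP no.
  have := cubic_card_darts_at u; have := card_darts [set e]; rewrite cards1.
  have : [set d : dart G | head d == u] \subset darts [set e].
    by apply/subsetP=> d; rewrite !inE => du; have := no d; rewrite du negbK.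
  by move/subset_leq_card; lia.
have du' : head (flip d) != u by rewrite -(eqP du) eq_sym cubic_loopless.
have con := cubic_del_vertex u.
apply: (connectedb_root (r := head (flip d))); rewrite ?inE // => v _.
have [->|vu] := eqVneq v u.
  apply/connect1/sub_adjP; rewrite !inE; split=> //; exists (flip d).
  by rewrite flip_darts flipK !inE de (eqP du).
apply: (@sub_adj_mono _ ([set: vert G] :\ u) [set e in [set: edge G] | ~~ incident e u]).
- exact: subsetT.
- apply/subsetP=> z; rewrite !inE andbT => zu; apply: contraNneq zu => ->.
  by apply/incidentP; exists false.
- by apply: connectedb_connect; rewrite ?inE ?du' ?vu.
Qed.

(** Five edges and two vertices disappear, so [beta] drops by 3 and becomes even. Eight vertices
    give [beta >= 5], which leaves at least 2. *)
Lemma removable_one_face x y : removable [set: vert G] [set: edge G] x y ->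
  8 <= #|vert G| ->
  one_face (del2E [set: edge G] x y).
Proof.
case/and5P=> _ _ xy /eqP j1 /andP[_ /andP[con xi1]] V8.
have := card_del2E xy j1; have := card_del2V xy; have := cubic_beta.
have hs := cubic_handshake => ob cV cE.
by apply: (xi_le1_one_face xi1); rewrite /beta; lia.
Qed.

End Cubic.

Lemma del2E_darts (G : graph) x y (d : dart G) :
  (d \in darts (del2E [set: edge G] x y)) =
  [&& head d != x, head d != y, head (flip d) != x & head (flip d) != y].
Proof.
rewrite !inE /incident /head /flip; case: d => e [] /=; rewrite !negb_or;
by case: ((ends e).1 == x); case: ((ends e).1 == y); case: ((ends e).2 == x);
   case: ((ends e).2 == y).
Qed.

Lemma not_incident_darts (G : graph) x (d : dart G) :
  (d \in darts [set e in [set: edge G] | ~~ incident e x]) =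
  (head d != x) && (head (flip d) != x).
Proof.
by rewrite !inE /incident /head /flip; case: d => e [] /=; rewrite !negb_or // andbC.
Qed.

(** * Connectivity of two-sums *)

Lemma dart_edge_eq (G : graph) (d d' : dart G) : d.1 = d'.1 -> d = d' \/ d = flip d'.
Proof.
by case: d d' => e [] [e' []] /= ->; rewrite /flip /=; [left|right|right|left].
Qed.

Section SumFacts.
Variables (G1 G2 G : graph) (e1 : edge G1) (e2 : edge G2).
Variables (v1 : vert G1 -> vert G) (v2 : vert G2 -> vert G).
Variables (i1 : dart G1 -> dart G) (i2 : dart G2 -> dart G) (c : bool).
Hypothesis ds : dart_sum e1 e2 v1 v2 i1 i2 c.

Let v12 x y : (v1 x == v2 y) = false. Proof. exact/negbTE/(dsv_disj ds). Qed.
Let v21 x y : (v2 x == v1 y) = false. Proof. by rewrite eq_sym v12. Qed.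
Let v11 x y : (v1 x == v1 y) = (x == y). Proof. exact: inj_eq (dsv1_inj ds) x y. Qed.
Let v22 x y : (v2 x == v2 y) = (x == y). Proof. exact: inj_eq (dsv2_inj ds) x y. Qed.

Lemma dart_sum_cross2 s : flip (i2 (e2, s)) = i1 (e1, s (+) c).
Proof. exact: (ds_flip_cross (dart_sum_sym ds)). Qed.

Lemma i1_edge d s : (i1 d).1 = (i1 (e1, s)).1 -> d = (e1, s).
Proof.
move/dart_edge_eq => [/(dsi1_inj ds)//|].
rewrite (ds_flip_cross ds) => h.
by have := dsi_disj ds d (e2, s (+) c); rewrite h eqxx.
Qed.

Lemma i2_edge d s : (i2 d).1 = (i1 (e1, s)).1 -> d.1 = e2.
Proof.
move/dart_edge_eq => [h|].
  by have := dsi_disj ds (e1, s) d; rewrite h eqxx.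
by rewrite (ds_flip_cross ds) => /(dsi2_inj ds)->.
Qed.

Lemma head_flip1 d : head (flip (i1 d)) =
  if d.1 == e1 then v2 (head ((e2, d.2 (+) c) : dart G2)) else v1 (head (flip d)).
Proof.
case: eqVneq => [|de]; last by rewrite (ds_flip1 ds) // (ds_head1 ds).
by case: d => e s /= ->; rewrite (ds_flip_cross ds) (ds_head2 ds).
Qed.

Lemma head_flip2 d : head (flip (i2 d)) =
  if d.1 == e2 then v1 (head ((e1, d.2 (+) c) : dart G1)) else v2 (head (flip d)).
Proof.
case: eqVneq => [|de]; last by rewrite (ds_flip2 ds) // (ds_head2 ds).
by case: d => e s /= ->; rewrite dart_sum_cross2 (ds_head1 ds).
Qed.

Lemma splits_setT : splits i1 i2 [set: edge G] [set: edge G1] [set: edge G2].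
Proof. by split=> d; rewrite !inE. Qed.

Lemma card_edge_sum : #|edge G| = #|edge G1| + #|edge G2|.
Proof. by have := card_splits ds splits_setT; rewrite !cardsT. Qed.

Lemma card_vert_sum : #|vert G| = #|vert G1| + #|vert G2|.
Proof.
have E : [set: vert G] = v1 @: [set: vert G1] :|: v2 @: [set: vert G2].
  apply/setP=> z; rewrite !inE; apply/esym/orP.
  by case: (dsv_cover ds z) => -[x ->]; [left|right]; apply: imset_f.
rewrite -!cardsT E cardsU disjoint_setI0 ?cards0 ?subn0.
  by rewrite (card_imset _ (dsv1_inj ds)) (card_imset _ (dsv2_inj ds)).
apply/pred0P => z /=; apply/negP => /andP[/imsetP[x _ ->] /imsetP[y _ /eqP]].
by rewrite v12.
Qed.

(** [G2 - e2] is connected and stands in for [e1]: a path in [G1] that uses [e1] takes a detour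
    through [G2]. The sets [W1] and [A1] let one argument serve both the sum and the sum minus a
    vertex of [G1]. *)
Lemma sum_connected (W1 : {set vert G1}) (A1 : {set edge G1})
    (W : {set vert G}) (ES : {set edge G}) s0 :
  connectedb W1 A1 -> connectedb [set: vert G2] ([set: edge G2] :\ e2) ->
  (forall z, (v1 z \in W) = (z \in W1)) -> (forall z, v2 z \in W) ->
  (forall d, d \in darts A1 -> d.1 != e1 -> i1 d \in darts ES) ->
  (forall d, d.1 != e2 -> i2 d \in darts ES) ->
  (forall s, head ((e1, s) : dart G1) \in W1 -> i1 (e1, s) \in darts ES) ->
  head ((e1, s0) : dart G1) \in W1 -> connectedb W ES.
Proof.
move=> con1 con2 W1E W2E E1 E2 E12 hs0.
have in2 z z' : connect (sub_adj W ES) (v2 z) (v2 z').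
  apply: (connect_hom (r := sub_adj [set: vert G2] ([set: edge G2] :\ e2))); last first.
    by apply: connectedb_connect; rewrite ?inE.
  move=> u v /sub_adjP[_ _ [d [dE hu hv]]]; rewrite !inE andbT in dE.
  apply/connect1/sub_adjP; rewrite !W2E; split=> //; exists (i2 d).
  by rewrite E2 // (ds_head2 ds) (ds_flip2 ds) // (ds_head2 ds) hu hv.
have cross s z : head ((e1, s) : dart G1) \in W1 ->
    connect (sub_adj W ES) (v2 z) (v1 (head ((e1, s) : dart G1))).
  move=> hs; rewrite connect_sub_adj_sym.
  apply: connect_trans (in2 (head ((e2, s (+) c) : dart G2)) z).
  apply/connect1/sub_adjP; rewrite W1E W2E; split=> //; exists (i1 (e1, s)).
  by rewrite E12 // (ds_head1 ds) (ds_flip_cross ds) (ds_head2 ds).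
have in1 z z' : z \in W1 -> z' \in W1 -> connect (sub_adj W ES) (v1 z) (v1 z').
  move=> zW zW'; apply: (connect_hom (r := sub_adj W1 A1)); last exact: connectedb_connect.
  move=> u v /sub_adjP[uW vW [d [dE hu hv]]]; have [de|de] := eqVneq d.1 e1; last first.
    apply/connect1/sub_adjP; rewrite !W1E; split=> //; exists (i1 d).
    by rewrite E1 // (ds_head1 ds) (ds_flip1 ds) // (ds_head1 ds) hu hv.
  case: d de hu hv {dE} => e s /= -> hu hv; rewrite -hu in uW; rewrite -hv in vW.
  rewrite -hu -hv; pose z0 := head ((e2, false) : dart G2).
  apply: (connect_trans (y := v2 z0)); last exact: cross.
  by rewrite connect_sub_adj_sym cross.
pose z0 := head ((e2, false) : dart G2).
apply: (connectedb_root (r := v2 z0)) => // w wW; case: (dsv_cover ds w) => -[z zE].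
  rewrite zE in wW *; rewrite W1E in wW.
  exact: connect_trans (cross s0 z0 hs0) (in1 _ _ hs0 wW).
by rewrite zE.
Qed.

Lemma sum_connected_full : cubic2 G1 -> cubic2 G2 ->
  connectedb [set: vert G] [set: edge G].
Proof.
move=> cub1 cub2.
apply: (sum_connected (s0 := false) (cubic_connected cub1) (cubic_not_bridge cub2 e2));
  by move=> *; rewrite ?inE.
Qed.

Lemma sum_connected_del1 x : cubic2 G1 -> cubic2 G2 ->
  connectedb ([set: vert G] :\ v1 x) [set e in [set: edge G] | ~~ incident e (v1 x)].
Proof.
move=> cub1 cub2.
have [s0 hs0] : exists s0, head ((e1, s0) : dart G1) != x.
  have [h|] := eqVneq (head ((e1, false) : dart G1)) x; last by exists false.
  by exists true; rewrite -h eq_sym (cubic_loopless cub1 (e1, false)).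
apply: (sum_connected (s0 := s0) (cubic_del_vertex cub1 x) (cubic_not_bridge cub2 e2)).
- by move=> z; rewrite !inE v11.
- by move=> z; rewrite !inE v21.
- move=> d; rewrite !not_incident_darts => dE /negPf de.
  by rewrite head_flip1 de (ds_head1 ds) !v11.
- by move=> d /negPf de; rewrite not_incident_darts head_flip2 de (ds_head2 ds) !v21.
- move=> s; rewrite in_setD1 => /andP[hs _].
  by rewrite not_incident_darts head_flip1 eqxx (ds_head1 ds) v11 v21 hs.
- by rewrite !inE hs0.
Qed.

Lemma sum_loopless : cubic2 G1 -> cubic2 G2 -> forall d : dart G, head d != head (flip d).
Proof.
move=> cub1 cub2 d; case: (dsi_cover ds d) => -[z ->].
  rewrite (ds_head1 ds) head_flip1; case: (z.1 =P e1) => _; first by rewrite v12.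
  by rewrite v11 cubic_loopless.
rewrite (ds_head2 ds) head_flip2; case: (z.1 =P e2) => _; first by rewrite v21.
by rewrite v22 cubic_loopless.
Qed.

(** All of [G2] is contracted to a surviving end [u] of [e1]. A surviving new edge then becomes the
    vertex [u] or, if it is attached to the other end, the edge [e1], so paths go to paths. *)
Lemma connected_retract x y s : head ((e1, s) : dart G1) != x -> head ((e1, s) : dart G1) != y ->
  connectedb (del2V [set: vert G] (v1 x) (v1 y)) (del2E [set: edge G] (v1 x) (v1 y)) ->
  connectedb (del2V [set: vert G1] x y) (del2E [set: edge G1] x y).
Proof.
move=> sx sy con; set u := head (e1, s) in sx sy.
(* The default value [u] is the image of every vertex of [G2]. *)
pose pr (z : vert G) : vert G1 := odflt u [pick a | v1 a == z].
have pr1 a : pr (v1 a) = a.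
  rewrite /pr; case: pickP => [b|/(_ a)]; last by rewrite eqxx.
  by rewrite v11 => /eqP.
have pr2 b : pr (v2 b) = u.
  by rewrite /pr; case: pickP => // a; rewrite v12.
pose A := sub_adj (del2V [set: vert G1] x y) (del2E [set: edge G1] x y).
have step z z' : sub_adj (del2V [set: vert G] (v1 x) (v1 y))
      (del2E [set: edge G] (v1 x) (v1 y)) z z' -> connect A (pr z) (pr z').
  case/sub_adjP=> _ _ [d [+ <- <-]]; rewrite del2E_darts => /and4P[].
  have cross t : head ((e1, t) : dart G1) != x -> head ((e1, t) : dart G1) != y ->
      connect A (head ((e1, t) : dart G1)) u.
    move=> tx ty; have [->|ts] := eqVneq t s; first exact: connect0.
    have tE : s = ~~ t by case: (s) (t) ts => [] [].
    apply/connect1/sub_adjP; split; rewrite ?inE ?negb_or ?tx ?ty ?sx ?sy //.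
    by exists (e1, t); rewrite del2E_darts /flip /= -tE -/u tx ty sx sy.
  case: (dsi_cover ds d) => -[z1 ->].
    rewrite (ds_head1 ds) head_flip1; case: (eqVneq z1.1 e1) => [|de].
      case: z1 => e t /= ->; rewrite !v11 => tx ty _ _; rewrite pr1 pr2; exact: cross.
    rewrite !v11 !pr1 => h1 h2 h3 h4; apply/connect1/sub_adjP.
    split; rewrite ?inE ?negb_or ?h1 ?h2 ?h3 ?h4 //.
    by exists z1; rewrite del2E_darts h1 h2 h3 h4.
  rewrite (ds_head2 ds) head_flip2; case: (eqVneq z1.1 e2) => [|de].
    case: z1 => e t /= ->; rewrite !v11 => _ _ tx ty; rewrite pr1 pr2 /A connect_sub_adj_sym.
    exact: cross.
  by rewrite !pr2 => *; exact: connect0.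
apply: (connectedb_root (r := u)); first by rewrite !inE negb_or sx sy.
move=> v; rewrite !inE negb_or andbT => /andP[vx vy].
rewrite -[X in connect _ X _](pr1 u) -[X in connect _ _ X](pr1 v).
apply: connect_hom step _; apply: connectedb_connect con _ _;
  by rewrite !inE negb_or !v11 ?sx ?sy ?vx ?vy.
Qed.

(** * Removable pairs of two-sums *)

Lemma splits_del2 x y :
  (forall s, head ((e1, s) : dart G1) != x) -> (forall s, head ((e1, s) : dart G1) != y) ->
  splits i1 i2 (del2E [set: edge G] (v1 x) (v1 y)) (del2E [set: edge G1] x y) [set: edge G2].
Proof.
move=> hx hy; split=> d; rewrite !del2E_darts.
  rewrite (ds_head1 ds) head_flip1; case: (eqVneq d.1 e1) => [|de]; last by rewrite !v11.
  by case: d => e s /= ->; rewrite /flip /= !hx !hy !v11 !v21 !hx !hy.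
have -> : d \in darts [set: edge G2] by rewrite !inE.
rewrite (ds_head2 ds) head_flip2 !v21; case: (eqVneq d.1 e2) => _; last by rewrite !v21.
by rewrite !v11 hx hy.
Qed.

(** One new edge is already missing; once the other is deleted too, the edge set splits. *)
Lemma splits_del_cross (ES : {set edge G}) (A1 : {set edge G1}) (A2 : {set edge G2}) s :
  e1 \notin A1 -> e2 \notin A2 -> i1 (e1, s) \notin darts ES ->
  (forall d, d.1 != e1 -> (i1 d \in darts ES) = (d \in darts A1)) ->
  (forall d, d.1 != e2 -> (i2 d \in darts ES) = (d \in darts A2)) ->
  splits i1 i2 (ES :\ (i1 (e1, ~~ s)).1) A1 A2.
Proof.
move=> eA1 eA2 sE E1 E2; split=> d.
  have [de|de] := eqVneq d.1 e1.
    rewrite [RHS]inE de (negPf eA1) !inE; case: d de => e t /= ->.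
    have [->|ts] := eqVneq t s; first by rewrite inE in sE; rewrite (negPf sE) andbF.
    have -> : t = ~~ s by case: (s) (t) ts => [] [].
    by rewrite eqxx.
  rewrite -E1 // !inE; case: eqP => // /i1_edge h.
  by rewrite h eqxx in de.
have [de|de] := eqVneq d.1 e2.
  rewrite [RHS]inE de (negPf eA2) !inE; case: d de => e t /= ->.
  have -> : (i2 (e2, t)).1 = (i1 (e1, t (+) c)).1 by rewrite -dart_sum_cross2.
  have [->|ts] := eqVneq (t (+) c) s; first by rewrite inE in sE; rewrite (negPf sE) andbF.
  have -> : t (+) c = ~~ s by case: (s) (t (+) c) ts => [] [].
  by rewrite eqxx.
rewrite -E2 // !inE; case: eqP => // /i2_edge h.
by rewrite h eqxx in de.
Qed.

(* Deleting the remaining edge between the summands from a one-face embedding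
   leaves at most two faces, at least one for each side. *)
Lemma one_face_split_cross (ES : {set edge G}) (A1 : {set edge G1}) (A2 : {set edge G2}) s :
  e1 \notin A1 -> e2 \notin A2 -> i1 (e1, s) \notin darts ES ->
  i1 (e1, ~~ s) \in darts ES ->
  (forall d, d.1 != e1 -> (i1 d \in darts ES) = (d \in darts A1)) ->
  (forall d, d.1 != e2 -> (i2 d \in darts ES) = (d \in darts A2)) ->
  one_face ES ->
  exists rho1 rho2, [/\ rotation_on (darts A1) rho1, rotation_on (darts A2) rho2 &
    nfaces A1 rho1 + nfaces A2 rho2 <= 2].
Proof.
move=> eA1 eA2 sE sE' E1 E2 [rho rot nf].
have spl := splits_del_cross eA1 eA2 sE E1 E2.
have [|rho' rot' nf'] := nfaces_delete rot (e := (i1 (e1, ~~ s)).1); first by rewrite inE in sE'.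
have [rho1 [rho2 [act rot1 rot2]]] := split_rotation ds spl rot'.
exists rho1, rho2; split=> //.
by have := nfaces_split_disconnected ds spl act rot' rot1 rot2 eA1; lia.
Qed.

Hypotheses (cub1 : cubic2 G1) (cub2 : cubic2 G2) (cub : cubic2 G).

Let V8 : 8 <= #|vert G|.
Proof.
by rewrite card_vert_sum; have := cubic_card_vert cub1; have := cubic_card_vert cub2; lia.
Qed.

Lemma sum_not_removable_cross x y :
  ~~ removable [set: vert G] [set: edge G] (v1 x) (v2 y).
Proof.
apply/negP => rem; have one := removable_one_face cub rem V8.
case/and5P: rem => _ _ _ /cards1P[e eE] _.
have : e \in [set e in [set: edge G] | joins e (v1 x) (v2 y)] by rewrite eE inE.
rewrite !inE /= => /joinsP[s' [hx hy]].
have [s [hs1 hs2]] : exists s, head ((e1, s) : dart G1) = x /\ head ((e2, s (+) c) : dart G2) = y.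
  move: hx hy; rewrite -[(e, ~~ s')]/(flip (e, s')).
  case: (dsi_cover ds (e, s')) => -[d ->].
    rewrite (ds_head1 ds) head_flip1; case: (eqVneq d.1 e1) => [|_].
      by case: d => e' t /= -> /(dsv1_inj ds) <- /(dsv2_inj ds) <-; exists t.
    by move=> _ /eqP; rewrite v12.
  by rewrite (ds_head2 ds) => /eqP; rewrite v21.
have [||||||rho1 [rho2 [rot1 rot2 nf]]] := @one_face_split_cross
  (del2E [set: edge G] (v1 x) (v2 y)) [set e in [set: edge G1] | ~~ incident e x]
  [set e in [set: edge G2] | ~~ incident e y] s _ _ _ _ _ _ one.
- by rewrite !inE negbK; apply/incidentP; exists s.
- by rewrite !inE negbK; apply/incidentP; exists (s (+) c).
- by rewrite del2E_darts (ds_head1 ds) hs1 eqxx.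
- rewrite del2E_darts (ds_head1 ds) head_flip1 eqxx v12 v21 v11 v22 -hs1 -hs2 /=.
  rewrite eq_sym (cubic_loopless cub1 (e1, s)) eq_sym addNb.
  exact: (cubic_loopless cub2 (e2, s (+) c)).
- move=> d /negPf de; rewrite del2E_darts not_incident_darts (ds_head1 ds) head_flip1 de.
  by rewrite !v11 !v12 /= andbT.
- move=> d /negPf de; rewrite del2E_darts not_incident_darts (ds_head2 ds) head_flip2 de.
  by rewrite !v21 !v22 /=.
have V1 := cubic_card_vert cub1; have V2 := cubic_card_vert cub2.
have c1 := card_not_incident cub1 x; have c2 := card_not_incident cub2 y.
have h1 := cubic_handshake cub1; have h2 := cubic_handshake cub2.
(* [G1 - x] has one vertex and three edges fewer than [G1], so its face count is even, hence at
   least 2. Together with a face of [G2 - y] this exceeds the bound 2. *)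
have p1 : odd (nfaces [set e in [set: edge G1] | ~~ incident e x] rho1) =
    odd (#|[set: vert G1] :\ x| + #|[set e in [set: edge G1] | ~~ incident e x]|).
  apply: nfaces_parity => // [d|v vV].
    by rewrite not_incident_darts !inE andbT => /andP[].
  apply: (connected_has_dart (cubic_del_vertex cub1 x) vV).
  by have := cardsD1 x [set: vert G1]; rewrite cardsT inE; lia.
have g1 : 0 < nfaces [set e in [set: edge G1] | ~~ incident e x] rho1.
  by apply: nfaces_gt0; rewrite -card_gt0; lia.
have g2 : 0 < nfaces [set e in [set: edge G2] | ~~ incident e y] rho2.
  by apply: nfaces_gt0; rewrite -card_gt0; lia.
have b1 := cubic_beta cub1.
by have := cardsD1 x [set: vert G1]; rewrite cardsT inE; move: p1; lia.
Qed.

(** If [e1] joined [x] and [y], it would be an edge between them in [G1] without a counterpart in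
    the sum. *)
Lemma sum_one_edge x y : ~~ joins e1 x y ->
  #|[set e in [set: edge G] | joins e (v1 x) (v1 y)]| = 1 ->
  #|[set e in [set: edge G1] | joins e x y]| = 1.
Proof.
move=> ne1 /eqP/cards1P[e eE].
have lift d1 : head d1 = x -> head (flip d1) = y -> d1.1 != e1 -> (i1 d1).1 = e.
  move=> hx hy de; apply/eqP; rewrite -in_set1 -eE !inE /=; apply/joinsP.
  exists (i1 d1).2; rewrite -surjective_pairing -[((i1 d1).1, _)]/(flip (i1 d1)).
  by rewrite (ds_head1 ds) head_flip1 (negPf de) hx hy.
have : e \in [set e in [set: edge G] | joins e (v1 x) (v1 y)] by rewrite eE inE.
rewrite !inE /= => /joinsP[s []]; rewrite -[(e, ~~ s)]/(flip (e, s)).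
case: (dsi_cover ds (e, s)) => -[d dE]; rewrite dE; last first.
  by rewrite (ds_head2 ds) => /eqP; rewrite v21.
rewrite (ds_head1 ds) head_flip1; case: (eqVneq d.1 e1) => [_ _ /eqP|de]; first by rewrite v21.
move=> /(dsv1_inj ds) hx /(dsv1_inj ds) hy.
apply/eqP/cards1P; exists d.1; apply/setP=> a; rewrite !inE /=; apply/idP/eqP => [ja|->].
  case/joinsP: (ja) => t [tx ty]; have ae : a != e1 by apply: contraNneq ne1 => <-.
  have /(congr1 fst) := dE; rewrite -(lift (a, t) tx ty ae) /= => /dart_edge_eq[].
    by move/(dsi1_inj ds) => <-.
  by rewrite (ds_flip1 ds) // => /(dsi1_inj ds) h; rewrite -[a]/(a, t).1 h.
apply/joinsP; exists d.2; rewrite -surjective_pairing; split=> //.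
Qed.

Lemma sum_not_removable_ends s :
  ~~ removable [set: vert G] [set: edge G]
       (v1 (head ((e1, s) : dart G1))) (v1 (head ((e1, ~~ s) : dart G1))).
Proof.
apply/negP => /and5P[_ _ _ _ /andP[_ /andP[con _]]].
set x := head _ in con; set y := head _ in con.
(* [G1] has at least four vertices, so one is left; each new edge has lost an end, so nothing leads
   from there to [G2]. *)
have [z zxy] : exists z, z \in del2V [set: vert G1] x y.
  apply/card_gt0P; have xy : x != y := cubic_loopless cub1 (e1, s).
  by have := card_del2V xy; have := cubic_card_vert cub1; lia.
pose w := v2 (head ((e2, false) : dart G2)).
have [||||d [+ /imsetP[a _ ha] _ _ fW]] := connected_crossing (u := v1 z) (v := w)
  (W := v1 @: [set: vert G1]) con.
- by move: zxy; rewrite !inE !v11.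
- by rewrite !inE !v21.
- exact: imset_f.
- by apply/imsetP => -[a _ /eqP]; rewrite v21.
rewrite del2E_darts; case: (dsi_cover ds d) ha fW => -[d' ->]; last first.
  by rewrite (ds_head2 ds) => /eqP; rewrite v21.
rewrite (ds_head1 ds) head_flip1 => _; case: (eqVneq d'.1 e1) => [|_]; last by rewrite imset_f ?inE.
case: d' => e t /= -> _; rewrite !v11 => /and3P[tx ty _].
by move: tx ty; rewrite /x /y; case: (t); case: (s); rewrite /= ?eqxx.
Qed.

Lemma sum_removable_side x y :
  removable [set: vert G] [set: edge G] (v1 x) (v1 y) ->
  removable [set: vert G1] [set: edge G1] x y.
Proof.
move=> rem; have one := removable_one_face cub rem V8.
have nends : ~~ joins e1 x y.
  by apply: contraTN rem => /joinsP[s [<- <-]]; exact: sum_not_removable_ends.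
case/and5P: rem => _ _ xy /eqP j1 /andP[_ /andP[con _]]; rewrite v11 in xy.
have j1' := sum_one_edge nends j1.
have [s sx sy] : exists2 s, head ((e1, s) : dart G1) != x & head ((e1, s) : dart G1) != y.
  have [|] := boolP [exists s, (head ((e1, s) : dart G1) != x) && (head ((e1, s) : dart G1) != y)].
    by case/existsP=> s /andP[]; exists s.
  rewrite negb_exists => /forallP no; case/negP: nends.
  have := no true; have := no false; have := cubic_loopless cub1 (e1, false); rewrite /flip /=.
  rewrite !negb_and !negbK => l /orP[] /eqP h /orP[] /eqP h'; move: l; rewrite h h' ?eqxx // => _.
    by apply/joinsP; exists false.
  by apply/joinsP; exists true.
have con1 := connected_retract sx sy con.
suff [rho1 rot1 nf1] : one_face (del2E [set: edge G1] x y).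
  apply/and5P; split; rewrite ?inE ?j1' //; apply/andP; split.
    by apply/forallP=> e; apply/implyP=> _; apply/implyP=> _; exact: cubic_not_bridge.
  rewrite /upper_embeddable con1 /=; apply: (xi_le1 rot1).
  by apply: leq_trans nf1 _; rewrite leq_addr.
have V2 := cubic_card_vert cub2; have h2 := cubic_handshake cub2.
have := cubic_beta cub2 => b2.
(* If the other end of [e1] is deleted, a single new edge remains: at most two faces are shared out,
   and [G2 - e2] takes at least one. *)
have [|off] := boolP ((head ((e1, ~~ s) : dart G1) == x) || (head ((e1, ~~ s) : dart G1) == y)).
  move=> on; have [||||||rho1 [rho2 [rot1 rot2 nf]]] := @one_face_split_cross
    (del2E [set: edge G] (v1 x) (v1 y)) (del2E [set: edge G1] x y)
    ([set: edge G2] :\ e2) (~~ s) _ _ _ _ _ _ one.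
  - suff : ((e1, ~~ s) : dart G1) \notin darts (del2E [set: edge G1] x y) by rewrite inE.
    by rewrite del2E_darts andbA -negb_or on.
  - by rewrite !inE eqxx.
  - by rewrite del2E_darts (ds_head1 ds) !v11 andbA -negb_or on.
  - by rewrite negbK del2E_darts (ds_head1 ds) head_flip1 eqxx !v11 !v21 sx sy.
  - by move=> d /negPf de; rewrite !del2E_darts (ds_head1 ds) head_flip1 de !v11.
  - by move=> d de; rewrite del2E_darts (ds_head2 ds) head_flip2 (negPf de) !v21 !inE de.
  exists rho1 => //.
  have : 0 < nfaces ([set: edge G2] :\ e2) rho2.
    apply: nfaces_gt0; rewrite -card_gt0.
    by have := cardsD1 e2 [set: edge G2]; rewrite cardsT inE; lia.
  by lia.
(* Here both new edges survive, so the second side of the splitting is the whole of [G2], to which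
   parity applies. *)
have spl : splits i1 i2 (del2E [set: edge G] (v1 x) (v1 y)) (del2E [set: edge G1] x y)
    [set: edge G2].
  move: off; rewrite negb_or => /andP[ox oy].
  by apply: splits_del2 => t; have [->|ts] := eqVneq t s => //;
    have -> : t = ~~ s by case: (s) (t) ts => [] [].
case: one => rho rot nf.
have [rho1 [rho2 [act rot1 rot2]]] := split_rotation ds spl rot.
have := nfaces_split ds spl act rot rot1 rot2.
have : odd (nfaces [set: edge G2] rho2) = odd (#|[set: vert G2]| + #|[set: edge G2]|).
  by apply: nfaces_parity => // v _; exact: cubic_covered.
have : 0 < nfaces [set: edge G2] rho2.
  by apply: nfaces_gt0; rewrite -card_gt0 cardsT; lia.
by rewrite !cardsT => g2 p2 sum12; exists rho1 => //; move: b2; lia.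
Qed.

End SumFacts.

(** * The odd two-sum *)

Section Sum2.
Variables (G1 G2 : graph) (e1 : edge G1) (e2 : edge G2).
Variables (f : bool -> (vert G1 * vert G2)%type) (c1 c2 : bool).
Hypothesis f1 : forall s, (f (s (+) c1)).1 = head ((e1, s) : dart G1).
Hypothesis f2 : forall s, (f (s (+) c2)).2 = head ((e2, s) : dart G2).

Let G := sum2 e1 e2 f.

(** A dart of [e1] becomes the dart, marked [false], that leaves the same vertex along the new edge
    attached there. The bit [c1] is the end of [e1] at which the new edge [false] is attached. *)
Definition sum2_dart1 (d : dart G1) : dart G :=
  if insub d.1 is Some a then (inl (inl a), d.2) else (inr (d.2 (+) c1), false).

Definition sum2_dart2 (d : dart G2) : dart G :=
  if insub d.1 is Some a then (inl (inr a), d.2) else (inr (d.2 (+) c2), true).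

Lemma sum2_dart1_new s : sum2_dart1 (e1, s) = (inr (s (+) c1), false).
Proof. by rewrite /sum2_dart1; case: insubP => //= a; rewrite eqxx. Qed.

Lemma sum2_dart2_new s : sum2_dart2 (e2, s) = (inr (s (+) c2), true).
Proof. by rewrite /sum2_dart2; case: insubP => //= a; rewrite eqxx. Qed.

Lemma sum2_dart1_old (a : {x : edge G1 | x != e1}) s :
  sum2_dart1 (val a, s) = (inl (inl a), s).
Proof. by rewrite /sum2_dart1 valK. Qed.

Lemma sum2_dart2_old (a : {x : edge G2 | x != e2}) s :
  sum2_dart2 (val a, s) = (inl (inr a), s).
Proof. by rewrite /sum2_dart2 valK. Qed.

Lemma dart_cases (H : graph) (e0 : edge H) (d : dart H) :
  (exists s, d = (e0, s)) \/ exists a : {x : edge H | x != e0}, exists s, d = (val a, s).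
Proof.
case: d => e s; have [->|ne] := eqVneq e e0; first by left; exists s.
by right; exists (Sub e ne), s.
Qed.

Lemma sum2_dart_sum :
  @dart_sum G1 G2 G e1 e2 inl inr sum2_dart1 sum2_dart2 (c1 (+) c2).
Proof.
split.
- by move=> x y [].
- by move=> x y [].
- by [].
- by case=> z; [left|right]; exists z.
- move=> d d'; case: (dart_cases e1 d) (dart_cases e1 d') => [[s ->]|[a [s ->]]].
    case=> [[s' ->]|[a [s' ->]]]; rewrite ?sum2_dart1_new ?sum2_dart1_old // => -[] h.
    by congr pair; exact: (can_inj (addbK c1)).
  by case=> [[s' ->]|[a' [s' ->]]]; rewrite ?sum2_dart1_new ?sum2_dart1_old // => -[] -> ->.
- move=> d d'; case: (dart_cases e2 d) (dart_cases e2 d') => [[s ->]|[a [s ->]]].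
    case=> [[s' ->]|[a [s' ->]]]; rewrite ?sum2_dart2_new ?sum2_dart2_old // => -[] h.
    by congr pair; exact: (can_inj (addbK c2)).
  by case=> [[s' ->]|[a' [s' ->]]]; rewrite ?sum2_dart2_new ?sum2_dart2_old // => -[] -> ->.
- move=> d d'; apply/eqP.
  case: (dart_cases e1 d) (dart_cases e2 d') => [[s ->]|[a [s ->]]] [[s' ->]|[a' [s' ->]]];
  by rewrite ?sum2_dart1_new ?sum2_dart1_old ?sum2_dart2_new ?sum2_dart2_old.
- case=> [[[a|a]|b]] s.
  + by left; exists (val a, s); rewrite sum2_dart1_old.
  + by right; exists (val a, s); rewrite sum2_dart2_old.
  + case: s; [right; exists (e2, b (+) c2)|left; exists (e1, b (+) c1)].
      by rewrite sum2_dart2_new addbK.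
    by rewrite sum2_dart1_new addbK.
- move=> d; case: (dart_cases e1 d) => [[s ->]|[a [s ->]]].
    by rewrite sum2_dart1_new -f1.
  by rewrite sum2_dart1_old /head /=; case: s.
- move=> d; case: (dart_cases e2 d) => [[s ->]|[a [s ->]]].
    by rewrite sum2_dart2_new -f2.
  by rewrite sum2_dart2_old /head /=; case: s.
- move=> d; case: (dart_cases e1 d) => [[s ->]|[a [s ->]] _]; first by rewrite eqxx.
  by rewrite /flip /= !sum2_dart1_old.
- move=> d; case: (dart_cases e2 d) => [[s ->]|[a [s ->]] _]; first by rewrite eqxx.
  by rewrite /flip /= !sum2_dart2_old.
- by move=> s; rewrite sum2_dart1_new sum2_dart2_new addbA addbK.
Qed.

End Sum2.

(** * From the data of an odd two-sum to the theorem *)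

Lemma end_of_deg2 (G : graph) (e : edge G) v :
  cubicb [set: vert G] [set: edge G] -> deg ([set: edge G] :\ e) v = 2 ->
  exists s, head ((e, s) : dart G) = v.
Proof.
move=> /forallP/(_ v); rewrite inE /= => /eqP d3 d2.
have [/existsP[s /eqP]|no] := boolP [exists s, head ((e, s) : dart G) == v]; first by exists s.
suff : deg ([set: edge G] :\ e) v = deg [set: edge G] v by rewrite d2 d3.
apply: eq_card => -[a s]; rewrite !inE andbT /=; have [->|//] := eqVneq a e.
by apply/esym/negbTE; move: no; rewrite negb_exists => /forallP/(_ s).
Qed.

Lemma twisted_ends (G : graph) (e : edge G) (u : bool -> vert G) :
  u false != u true -> (forall b, exists s, head ((e, s) : dart G) = u b) ->
  exists c, forall s, u (s (+) c) = head ((e, s) : dart G).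
Proof.
move=> ne ends; have [s0 h0] := ends false; have [s1 h1] := ends true.
have s01 : s1 = ~~ s0.
  by move: ne; rewrite -h0 -h1; case: (s0); case: (s1); rewrite ?eqxx.
exists s0 => s; rewrite s01 in h1; case: s s0 h0 h1 {s01 s1} => [] [] //=.
Qed.

Lemma cubic2_sum G1 G2 G e1 e2 v1 v2 i1 i2 c :
  @dart_sum G1 G2 G e1 e2 v1 v2 i1 i2 c -> cubic2 G1 -> cubic2 G2 ->
  cubicb [set: vert G] [set: edge G] -> cubic2 G.
Proof.
move=> ds cub1 cub2 cub; have ds' := dart_sum_sym ds; split=> //.
- apply/and4P; split.
  + exact: (sum_connected_full ds).
  + by rewrite cardsT (card_vert_sum ds); have := cubic_card_vert cub1; lia.
  + apply/forallP=> e; apply/implyP=> _; exact: (sum_loopless ds cub1 cub2 (e, false)).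
  + apply/forallP=> v; apply/implyP=> _; case: (dsv_cover ds v) => -[z ->].
      exact: (sum_connected_del1 ds).
    exact: (sum_connected_del1 ds').
- rewrite /beta !cardsT (card_vert_sum ds) (card_edge_sum ds).
  have := cubic_beta cub1; have := cubic_beta cub2.
  by have := cubic_handshake cub1; have := cubic_handshake cub2; lia.
Qed.

Lemma xi_sum_le1 G1 G2 G e1 e2 v1 v2 i1 i2 c :
  @dart_sum G1 G2 G e1 e2 v1 v2 i1 i2 c -> cubic2 G1 -> cubic2 G2 -> cubic2 G ->
  odd_edge e1 -> odd_edge e2 -> xi [set: vert G] [set: edge G] <= 1.
Proof.
move=> ds cub1 cub2 cub o1 o2.
have [|rho1 [rot1 nf1 sep1]] := odd_edge_two_faces _ o1.
  exact: leq_trans (cubic_card_vert cub1).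
have [|rho2 [rot2 nf2 _]] := odd_edge_two_faces _ o2.
  exact: leq_trans (cubic_card_vert cub2).
have spl := splits_setT i1 i2.
have [rho act rot] := glue_rotation ds spl rot1 rot2.
apply: (xi_le1 rot); case: cub => _ _ ->.
by have := nfaces_glue ds spl act rot rot1 rot2 sep1; rewrite nf1 nf2; lia.
Qed.

Theorem theorem18 (G1 G2 : graph) (e1 : edge G1) (e2 : edge G2)
    (f : bool -> (vert G1 * vert G2)%type) :
  two_connected G1 -> two_connected G2 ->
  tightly_two_face_embeddable G1 -> tightly_two_face_embeddable G2 ->
  odd_edge e1 -> odd_edge e2 ->
  odd2sum_data e1 e2 f ->
  two_connected (sum2 e1 e2 f) /\ tightly_two_face_embeddable (sum2 e1 e2 f).
Proof.
move=> tc1 tc2 /andP[/and3P[q1 _ b1] nr1] /andP[/and3P[q2 _ b2] nr2] o1 o2.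
case/and5P=> /forallP d1 /forallP d2 ne1 ne2 q.
have cub1 : cubic2 G1 by split.
have cub2 : cubic2 G2 by split.
have [|c1 f1] := @twisted_ends G1 e1 (fun b => (f b).1) ne1.
  by move=> b; apply: end_of_deg2 => //; exact/eqP.
have [|c2 f2] := @twisted_ends G2 e2 (fun b => (f b).2) ne2.
  by move=> b; apply: end_of_deg2 => //; exact/eqP.
have ds := sum2_dart_sum f1 f2; have ds' := dart_sum_sym ds.
have cub := cubic2_sum ds cub1 cub2 q.
case: (cub) => tc _ b; split=> //; apply/andP; split.
  apply/and3P; split=> //; apply/andP; split; first exact: cubic_connected.
  exact: (xi_sum_le1 ds).
apply/negP => /existsP[x /existsP[y rem]].
(* The description by darts is symmetric: [ds'] exchanges the summands, so two arguments cover all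
   four positions of the pair. *)
case: x y rem => [x|x] [y|y] rem.
- case/negP: nr1; apply/existsP; exists x; apply/existsP; exists y.
  exact: (sum_removable_side ds cub1 cub2 cub rem).
- by have := sum_not_removable_cross ds cub1 cub2 cub x y; rewrite rem.
- by have := sum_not_removable_cross ds' cub2 cub1 cub x y; rewrite rem.
- case/negP: nr2; apply/existsP; exists x; apply/existsP; exists y.
  exact: (sum_removable_side ds' cub2 cub1 cub rem).
Qed.
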